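(* Let $g \geq 4$ and $w \geq 4$ be integers. Then the weight $w$ part of the second homology group of the Lie algebra $\mathfrak{c}_g^+$ vanishes: $H_2(\mathfrak{c}_g^+)_w = 0$.
   Context: Let $H = \mathbb{Q}^{2g}$ be the fundamental representation of $\mathrm{Sp}(2g;\mathbb{Q})$, with symplectic form $\mu\colon H\otimes H\to\mathbb{Q}$ and symplectic basis $a_1,\dots,a_g,b_1,\dots,b_g$: $\mu(a_i,a_j)=\mu(b_i,b_j)=0$, $\mu(a_i,b_j)=-\mu(b_j,a_i)=\delta_{ij}$. For $w\ge 0$ put $\mathfrak{c}_g(w)=S^{w+2}H$ (symmetric power), whose elements are said to have weight $w$. Let $\mathfrak{c}_g=\bigoplus_{w\ge 0}\mathfrak{c}_g(w)$ and $\mathfrak{c}_g^+=\bigoplus_{w\ge 1}\mathfrak{c}_g(w)$. The Lie bracket on $\mathfrak{c}_g$ is the bilinear extension of $$[x_1\cdots x_{k+2},\,y_1\cdots y_{l+2}]=\sum_{i=1}^{k+2}\sum_{j=1}^{l+2}\mu(x_i,y_j)\,x_1\cdots\widehat{x_i}\cdots x_{k+2}\,y_1\cdots\widehat{y_j}\cdots y_{l+2}\in\mathfrak{c}_g(k+l)$$ for $x_i,y_j\in H$ (the Poisson bracket on polynomials); $\mathfrak{c}_g^+$ is a Lie subalgebra. $H_\bullet(\mathfrak{c}_g^+)$ is the Lie algebra homology with trivial coefficients $\mathbb{Q}$, i.e. the homology of the Chevalley–Eilenberg complex $(\wedge^\bullet\mathfrak{c}_g^+,\partial_\bullet)$ with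 $$\partial_n(f_1\wedge\cdots\wedge f_n)=\sum_{1\le i<j\le n}(-1)^{i+j+1}[f_i,f_j]\wedge f_1\wedge\cdots\widehat{f_i}\cdots\widehat{f_j}\cdots\wedge f_n .$$ An element $f_1\wedge\cdots\wedge f_n$ with $f_i\in\mathfrak{c}_g(k_i)$ has weight $k_1+\cdots+k_n$. The differential preserves weight, so $H_n(\mathfrak{c}_g^+)=\bigoplus_w H_n(\mathfrak{c}_g^+)_w$, where $H_n(\mathfrak{c}_g^+)_w$ is the homology of the weight $w$ subcomplex. *)

(* Defs.v *)
From HB Require Import structures.
From mathcomp Require Import all_boot all_order all_algebra.
From mathcomp Require Import boolp zify.
From mathcomp.multinomials Require Import freeg mpoly.

Set Implicit Arguments.
Unset Strict Implicit.
Unset Printing Implicit Defensive.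

Import GRing.Theory.
Local Open Scope ring_scope.
Local Open Scope quotient_scope.

Section Span.
Variables (K : fieldType) (V : lmodType K) (G : V -> Prop).

Definition span_mem (v : V) : Prop :=
  exists s : seq (K * V),
    (forall t, t \in s -> G t.2) /\ v = \sum_(t <- s) t.1 *: t.2.

Definition span : pred V := [pred v | `[< span_mem v >]].

Lemma spanP v : reflect (span_mem v) (v \in span).
Proof. exact: asboolP. Qed.

Lemma span_submod_closed : submod_closed span.
Proof.
split; first by apply/spanP; exists [::]; rewrite big_nil.
move=> a u v /spanP[s [Gs ->]] /spanP[t [Gt ->]]; apply/spanP.
exists ([seq (a * x.1, x.2) | x <- s] ++ t); split.
  move=> x; rewrite mem_cat => /orP[/mapP[y ys ->]|/Gt//].
  exact: (Gs y).
rewrite big_cat big_map scaler_sumr; congr (_ + _).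
by apply: eq_bigr => x _; rewrite scalerA.
Qed.

HB.instance Definition _ := GRing.isSubmodClosed.Build K V span
  span_submod_closed.

Lemma span_gen v : G v -> v \in span.
Proof.
move=> Gv; apply/spanP; exists [:: (1, v)]; rewrite big_seq1 scale1r.
by split=> // x; rewrite inE => /eqP->.
Qed.

End Span.

Section QuotientModule.
Variables (K : fieldType) (V : lmodType K) (S : submodClosed V).

Definition quot_ker : pred V := [pred v | v \in S].

Lemma quot_ker_zmod_closed : zmod_closed quot_ker.
Proof.
split=> [|u v Su Sv]; first exact: (rpred0 S).
change (u - v \in S); by rewrite -[- v]scaleN1r rpredD ?rpredZ.
Qed.

HB.instance Definition _ := GRing.isZmodClosed.Build V quot_ker
  quot_ker_zmod_closed.

Definition quot_zmod : Type := Quotient.quot (GRing.ZmodClosed.clone V quot_ker _).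
Definition quot_mod : Type := quot_zmod.
HB.instance Definition _ := GRing.Zmodule.on quot_mod.

Definition quot_pi (v : V) : quot_mod := \pi_(quot_zmod) v.
Definition quot_scale (a : K) (z : quot_mod) : quot_mod :=
  quot_pi (a *: repr (z : quot_zmod)).

Lemma quot_piE u v : (quot_pi u == quot_pi v) = (u - v \in S).
Proof.
by have := Quotient.idealrBE (GRing.ZmodClosed.clone V quot_ker _) u v; move=> <-.
Qed.

Lemma quot_pi_repr (z : quot_mod) : quot_pi (repr (z : quot_zmod)) = z.
Proof. exact: reprK. Qed.

Lemma quot_piB u v : quot_pi (u - v) = quot_pi u - quot_pi v.
Proof. exact: (raddfB (\pi_(quot_zmod))). Qed.

HB.instance Definition _ := GRing.isZmodMorphism.Build V quot_mod quot_pi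
  quot_piB.

Lemma quot_scale_pi a v : quot_scale a (quot_pi v) = quot_pi (a *: v).
Proof.
apply/eqP; rewrite quot_piE -scalerBr rpredZ //.
by rewrite -quot_piE quot_pi_repr.
Qed.

Lemma quot_scaleA a b z :
  quot_scale a (quot_scale b z) = quot_scale (a * b) z.
Proof. by rewrite -(quot_pi_repr z) !quot_scale_pi scalerA. Qed.

Lemma quot_scale1 : left_id 1 quot_scale.
Proof. by move=> z; rewrite -(quot_pi_repr z) quot_scale_pi scale1r. Qed.

Lemma quot_scaleDr : right_distributive quot_scale +%R.
Proof.
move=> a y z; rewrite -(quot_pi_repr y) -(quot_pi_repr z) -raddfD.
by rewrite !quot_scale_pi -raddfD scalerDr.
Qed.

Lemma quot_scaleDl z : {morph quot_scale^~ z : a b / a + b}.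
Proof.
by move=> a b; rewrite -(quot_pi_repr z) !quot_scale_pi -raddfD scalerDl.
Qed.

HB.instance Definition _ := GRing.Zmodule_isLmodule.Build K quot_mod
  quot_scaleA quot_scale1 quot_scaleDr quot_scaleDl.

Lemma quot_piZ : scalable quot_pi.
Proof. by move=> a v; rewrite -quot_scale_pi. Qed.

HB.instance Definition _ := GRing.isScalable.Build K V quot_mod *:%R quot_pi
  quot_piZ.

Lemma quot_pi_eq0 v : (quot_pi v == 0) = (v \in S).
Proof. by rewrite -(linear0 quot_pi) quot_piE subr0. Qed.

End QuotientModule.

Section Multilinear.
Variables (K : fieldType) (V W : lmodType K) (n : nat).
Implicit Types (f : {ffun 'I_n -> V}) (phi : {ffun 'I_n -> V} -> W).

Definition upd f (i : 'I_n) (x : V) : {ffun 'I_n -> V} :=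
  [ffun k => if k == i then x else f k].

Definition multilinear phi := forall f i a x y,
  phi (upd f i (a *: x + y)) = a *: phi (upd f i x) + phi (upd f i y).

Definition alternating phi := forall f i j,
  i != j -> f i = f j -> phi f = 0.

Lemma upd_id f i : upd f i (f i) = f.
Proof. by apply/ffunP=> k; rewrite ffunE; case: eqP => [->|]. Qed.

Lemma updK f i x y : upd (upd f i x) i y = upd f i y.
Proof. by apply/ffunP=> k; rewrite !ffunE; case: eqP. Qed.

Lemma updC f i j x y : i != j -> upd (upd f i x) j y = upd (upd f j y) i x.
Proof.
move=> ij; apply/ffunP=> k; rewrite !ffunE; case: (k =P j) => [->|//].
by rewrite eq_sym (negPf ij).
Qed.

Lemma multilinearD phi f i x y : multilinear phi ->
  phi (upd f i (x + y)) = phi (upd f i x) + phi (upd f i y).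
Proof. by move=> ml; rewrite -[x]scale1r ml !scale1r. Qed.

Lemma multilinear0 phi f i : multilinear phi -> f i = 0 -> phi f = 0.
Proof.
move=> ml fi; rewrite -(upd_id f i) fi.
have := multilinearD f i 0 0 ml; rewrite addr0 => /eqP.
by rewrite -subr_eq subrr => /eqP.
Qed.

Lemma alternating_adjacent phi : multilinear phi ->
  (forall f (i j : 'I_n), j = i.+1 :> nat -> f i = f j -> phi f = 0) ->
  alternating phi.
Proof.
move=> ml adj.
have swap f (i j : 'I_n) : j = i.+1 :> nat ->
    phi f = - phi (upd (upd f i (f j)) j (f i)).
  move=> ji; have ij : i != j by rewrite -val_eqE /= ji neq_ltn ltnSn.
  pose h x y := phi (upd (upd f i x) j y).
  have hD x x' y : h (x + x') y = h x y + h x' y.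
    by rewrite /h !(updC _ _ _ ij) multilinearD.
  have hD' x y y' : h x (y + y') = h x y + h x y' by rewrite /h multilinearD.
  have h0 x : h x x = 0.
    by apply: (adj _ i j ji); rewrite !ffunE (negPf ij) !eqxx.
  have := h0 (f i + f j); rewrite hD !hD' !h0 add0r addr0 => /eqP.
  by rewrite addr_eq0 /h upd_id upd_id => /eqP.
suff main d f (i j : 'I_n) : j = (i + d.+1)%N :> nat -> f i = f j -> phi f = 0.
  move=> f i j; rewrite -val_eqE neq_ltn => /orP[] lt fij.
    by apply: (main (j - i).-1 f i j) => //; rewrite prednK ?subn_gt0 // subnKC // ltnW.
  by apply: (main (i - j).-1 f j i) => //; rewrite prednK ?subn_gt0 // subnKC // ltnW.
elim: d f j => [|d IHd] f j ji fij; first by apply: adj fij; rewrite ji addn1.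
have jn : (j.-1 < n)%N by rewrite (leq_ltn_trans (leq_pred _)).
pose k := Ordinal jn.
have jk : j = k.+1 :> nat by rewrite /= prednK // ji addnS.
have ki : k = (i + d.+1)%N :> nat by rewrite /= ji addnS.
rewrite (swap f k j jk) (IHd _ k ki) ?oppr0 // !ffunE eqxx.
have /negPf-> : i != j by rewrite -val_eqE /= ji addnS neq_ltn ltnS leq_addr.
have /negPf-> : i != k by rewrite -val_eqE [val k]ki /= addnS neq_ltn ltnS leq_addr.
have /negPf-> // : k != j by rewrite -val_eqE [val j]jk neq_ltn ltnSn.
Qed.

End Multilinear.

(* The n-th exterior power of V: the free module on n-tuples of vectors modulo
   the submodule generated by the multilinearity and alternation relations. *)
Section ExteriorPower.
Variables (K : fieldType) (V : lmodType K) (n : nat).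

Notation free := {freeg {ffun 'I_n -> V} / K}.

Definition ext_rel (u : free) : Prop :=
  (exists f i a x y,
     u = << upd f i (a *: x + y) >> - (a *: << upd f i x >> + << upd f i y >>))
  \/ (exists (f : {ffun 'I_n -> V}) i j, [/\ i != j, f i = f j & u = << f >>]).

Definition ext_ker := GRing.SubmodClosed.clone K free (span ext_rel) _.

Definition ext : Type := quot_mod ext_ker.
HB.instance Definition _ := GRing.Lmodule.on ext.

Definition ext_pi (u : free) : ext := quot_pi ext_ker u.
HB.instance Definition _ := GRing.Linear.copy ext_pi (quot_pi ext_ker).

Definition wedge (f : {ffun 'I_n -> V}) : ext := ext_pi << f >>.

Lemma wedge_multilinear : multilinear wedge.
Proof.
move=> f i a x y; rewrite /wedge -linearP; apply/eqP.
rewrite /ext_pi quot_piE; apply: span_gen; left.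
by exists f, i, a, x, y.
Qed.

Lemma wedge_alternating : alternating wedge.
Proof.
move=> f i j ij fij; apply/eqP; rewrite /wedge /ext_pi quot_pi_eq0.
by apply: span_gen; right; exists f, i, j.
Qed.

Section Lift.
Variables (W : lmodType K) (phi : {ffun 'I_n -> V} -> W).

Definition ext_lift (z : ext) : W :=
  fglift phi (repr (z : quot_zmod ext_ker)).

Hypotheses (ml : multilinear phi) (alt : alternating phi).

Let fgliftB : {morph fglift phi : u v / u - v}.
Proof. exact: lift_is_additive. Qed.

Let fglift0 : fglift phi 0 = 0.
Proof. by rewrite -(subrr 0) fgliftB subrr. Qed.

Let fgliftD : {morph fglift phi : u v / u + v}.
Proof.
by move=> u v; rewrite -{1}[v]opprK fgliftB -sub0r fgliftB fglift0 sub0r opprK.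
Qed.

Let fgliftZ a u : fglift phi (a *: u) = a *: fglift phi u.
Proof.
rewrite -[u]freeg_sumE scaler_sumr !(big_morph _ fgliftD fglift0) scaler_sumr.
apply: eq_bigr => k _.
have ->: a *: << coeff k u *g k >> = << a * coeff k u *g k >> :> free.
  by apply/eqP/freeg_eqP=> y; rewrite coeffZ !coeffU mulrA.
by rewrite !liftU scalerA.
Qed.

Let fglift_rel u : u \in span ext_rel -> fglift phi u = 0.
Proof.
move=> /spanP[s [Gs ->]]; rewrite (big_morph _ fgliftD fglift0) big_seq big1 //.
move=> t /Gs; rewrite fgliftZ => -[[f [i [a [x [y ->]]]]]|[f [i [j [ij fij ->]]]]].
  by rewrite fgliftB fgliftD fgliftZ !liftU !scale1r ml subrr scaler0.
by rewrite liftU (alt ij fij) !scaler0.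
Qed.

Lemma ext_lift_pi u : ext_lift (ext_pi u) = fglift phi u.
Proof.
apply/eqP; rewrite -subr_eq0 -fgliftB fglift_rel //.
by rewrite -quot_piE quot_pi_repr.
Qed.

Lemma ext_lift_wedge f : ext_lift (wedge f) = phi f.
Proof. by rewrite ext_lift_pi liftU scale1r. Qed.

Lemma ext_lift_linear : linear ext_lift.
Proof.
move=> a y z; rewrite -[y]quot_pi_repr -[z]quot_pi_repr -!/(ext_pi _) -linearP.
by rewrite !ext_lift_pi fgliftD fgliftZ.
Qed.

End Lift.

End ExteriorPower.

HB.mixin Record Lmodule_isLie (K : fieldType) V of GRing.Lmodule K V := {
  lie : V -> V -> V;
  lie_linearl : forall y, linear (lie^~ y);
  lie_linearr : forall x, linear (lie x);
  liexx : forall x, lie x x = 0;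
  lie_jacobi : forall x y z,
    lie x (lie y z) + lie y (lie z x) + lie z (lie x y) = 0
}.

#[short(type="lieType")]
HB.structure Definition Lie (K : fieldType) :=
  {V of GRing.Lmodule K V & Lmodule_isLie K V}.

Section ChevalleyEilenberg.
Variables (K : fieldType) (L : lieType K).

(* The indices 0 .. n+1 other than i and j, in increasing order (for i < j). *)
Definition ce_rest n (i j : 'I_n.+2) (k : 'I_n) : 'I_n.+2 :=
  inord (bump j (bump i k)).

(* The entries of [f_i, f_j] /\ f_0 /\ .. ^f_i .. ^f_j .. /\ f_(n+1). *)
Definition ce_args n (f : {ffun 'I_n.+2 -> L}) (i j : 'I_n.+2) :
    {ffun 'I_n.+1 -> L} :=
  [ffun k => if unlift ord0 k is Some k' then f (ce_rest i j k')
             else lie (f i) (f j)].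

(* Indices start at 0 here; this does not change the parity of i + j + 1. *)
Definition ce_form n : {ffun 'I_n -> L} -> ext L n.-1 :=
  match n return {ffun 'I_n -> L} -> ext L n.-1 with
  | n'.+2 => fun f =>
      \sum_(i < n'.+2) \sum_(j < n'.+2 | (i < j)%N)
        (-1) ^+ (i + j + 1) *: wedge (ce_args f i j)
  | _ => fun=> 0
  end.

Local Notation lift := fintype.lift.

Let lift_neq n (h : 'I_n) k :
  ((lift h k == h) = false) * ((h == lift h k) = false).
Proof. by rewrite eq_sym (negPf (neq_lift _ _)). Qed.

Let bump2_lt n a b (k : 'I_n) : (bump a (bump b k) < n.+2)%N.
Proof. by rewrite /bump; have := ltn_ord k; lia. Qed.

Section Rest.
Variables (n : nat) (i j : 'I_n.+2).
Hypothesis ij : (i < j)%N.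

Let restE k : ce_rest i j k = bump j (bump i k) :> nat.
Proof. by rewrite inordK // bump2_lt. Qed.

Lemma ce_rest_inj : injective (ce_rest i j).
Proof.
move=> k l /(congr1 val) /=; rewrite !restE => H; apply: val_inj => /=.
by move: H; rewrite /bump; lia.
Qed.

Lemma ce_rest_neq k : ((ce_rest i j k == i) = false) * ((i == ce_rest i j k) = false) *
  ((ce_rest i j k == j) = false) * ((j == ce_rest i j k) = false).
Proof.
rewrite ![_ == ce_rest _ _ _]eq_sym.
suff: (ce_rest i j k != i) && (ce_rest i j k != j) by case/andP=> /negPf-> /negPf->.
by rewrite -!val_eqE /= !restE /bump; lia.
Qed.

Lemma ce_restP p : p != i -> p != j -> exists k, p = ce_rest i j k.
Proof.
rewrite -!val_eqE /= => pi pj.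
have kn : (unbump i (unbump j p) < n)%N.
  by rewrite /unbump; have := ltn_ord p; have := ltn_ord j; lia.
exists (Ordinal kn); apply: val_inj; rewrite /= restE /= /bump /unbump.
by lia.
Qed.

Lemma ce_args_upd (f : {ffun 'I_n.+2 -> L}) (p : 'I_n.+2) :
  exists (k : 'I_n.+1) (h : L -> L), linear h /\
    forall x, ce_args (upd f p x) i j = upd (ce_args f i j) k (h x).
Proof.
have ne : (i == j = false) * (j == i = false).
  by rewrite -!val_eqE /=; split; lia.
have [->|pi] := eqVneq p i.
  exists ord0, (lie^~ (f j)); split; first exact: lie_linearl.
  move=> x; apply/ffunP=> k; rewrite !ffunE eqxx ne.
  case: (unliftP ord0 k) => [k'|] ->; last by rewrite eqxx.
  by rewrite lift_neq ffunE ce_rest_neq.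
have [->|pj] := eqVneq p j.
  exists ord0, (lie (f i)); split; first exact: lie_linearr.
  move=> x; apply/ffunP=> k; rewrite !ffunE eqxx ne.
  case: (unliftP ord0 k) => [k'|] ->; last by rewrite eqxx.
  by rewrite lift_neq ffunE ce_rest_neq.
have [p' ->] := ce_restP pi pj.
exists (lift ord0 p'), id; split=> // x; apply/ffunP=> k; rewrite !ffunE.
rewrite !ce_rest_neq; case: (unliftP ord0 k) => [k'|] ->; last by rewrite lift_neq.
by rewrite ffunE (inj_eq ce_rest_inj) (inj_eq lift_inj).
Qed.

Lemma ce_args_alt (f : {ffun 'I_n.+2 -> L}) p q :
  p != q -> f p = f q -> p != i -> p != j -> q != i -> q != j ->
  wedge (ce_args f i j) = 0.
Proof.
move=> pq fpq pi pj qi qj.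
have [k Ek] := ce_restP pi pj; have [l El] := ce_restP qi qj.
apply: (@wedge_alternating _ _ _ _ (lift ord0 k) (lift ord0 l)).
  by apply: contra_neq pq => /lift_inj kl; rewrite Ek El kl.
by rewrite !ffunE !liftK -Ek -El.
Qed.

End Rest.

Lemma ce_form_multilinear n : multilinear (@ce_form n).
Proof.
case: n => [|[|n]] f p a x y /=; rewrite ?scaler0 ?addr0 //.
rewrite scaler_sumr -big_split; apply: eq_bigr => i _ /=.
rewrite scaler_sumr -big_split; apply: eq_bigr => j ij /=.
have [k [h [hl E]]] := ce_args_upd ij f p.
by rewrite !E hl wedge_multilinear scalerDr !scalerA mulrC.
Qed.

Let sum_cancel (I : finType) (W : zmodType) (F : I -> W) (C A : pred I)
    (s : I -> I) :
  involutive s -> (forall x, ~~ C x -> F x = 0) ->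
  (forall x, C x -> [/\ C (s x), A (s x) = ~~ A x & F (s x) = - F x]) ->
  \sum_x F x = 0.
Proof.
move=> sK F0 H; rewrite (bigID C) /= [X in _ + X]big1 ?addr0 //.
rewrite (bigID A) /= [X in _ + X](reindex_inj (inv_inj sK)) /=.
apply/eqP; rewrite addr_eq0 -sumrN; apply/eqP.
have Cs x : C (s x) = C x.
  by apply/idP/idP=> /H[]//; rewrite sK.
rewrite (eq_bigl (fun x => C x && ~~ A (s x))) => [|x]; last first.
  by case Cx: (C x) => //; have [_ -> _] := H _ Cx; rewrite negbK.
rewrite [RHS](eq_bigl (fun x => C x && ~~ A (s x))) => [|x]; last by rewrite Cs.
by apply: eq_bigr => x /andP[/H[_ _ ->] _]; rewrite opprK.
Qed.

Lemma ce_form_alternating n : alternating (@ce_form n).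
Proof.
apply: alternating_adjacent; first exact: ce_form_multilinear.
case: n => [|[|n]] f p q qp fpq //=.
have pq : p != q by rewrite -val_eqE /= qp; lia.
pose F (x : 'I_n.+2 * 'I_n.+2) := if (x.1 < x.2)%N then
  (-1) ^+ (x.1 + x.2 + 1) *: wedge (ce_args f x.1 x.2) else 0.
transitivity (\sum_x F x).
  by rewrite -(pair_bigA _ (fun i j => F (i, j))) /=; apply: eq_bigr => i _; rewrite big_mkcond.
pose t (i : 'I_n.+2) := if i == p then q else if i == q then p else i.
have qp' : (q == p) = false by rewrite eq_sym (negPf pq).
have tK : involutive t.
  move=> i; rewrite /t; case: (eqVneq i p) => [->|ip]; first by rewrite qp' eqxx.
  by case: (eqVneq i q) => [->|iq]; rewrite ?eqxx // (negPf ip) (negPf iq).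
pose s (x : 'I_n.+2 * 'I_n.+2) := (t x.1, t x.2).
pose A (x : 'I_n.+2 * 'I_n.+2) := (x.1 == p) || (x.2 == p).
pose B (x : 'I_n.+2 * 'I_n.+2) := (x.1 == q) || (x.2 == q).
pose C (x : 'I_n.+2 * 'I_n.+2) := (x.1 < x.2)%N && (A x (+) B x).
apply: (@sum_cancel _ _ F C A s).
- by case=> i j; rewrite /s /= !tK.
- case=> i j; rewrite /C /F /=; case: ifP => //= ij.
  rewrite negb_add => /eqP AB.
  suff -> : wedge (ce_args f i j) = 0 by rewrite scaler0.
  case Aij: (A (i, j)) AB => /esym; last first.
    move: Aij => /negbT; rewrite /A /B /= negb_or => /andP[ip jp] /negbT.
    rewrite negb_or => /andP[iq jq].
    by apply: (ce_args_alt ij pq fpq); rewrite eq_sym.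
  move: Aij; rewrite /A /B /= => Aij Bij.
  have [Ei Ej] : i = p /\ j = q.
    by move: Aij Bij; rewrite -!val_eqE /= => Aij Bij; split; apply: val_inj => /=; lia.
  apply: (multilinear0 (i := ord0) (@wedge_multilinear _ _ _)).
  by rewrite ffunE unlift_none Ei Ej fpq liexx.
- case=> i j /andP[/= ij AB].
  have tE (k : 'I_n.+2) : (k = p :> nat /\ t k = p.+1 :> nat) \/ (k = p.+1 :> nat /\ t k = p :> nat)
      \/ (k <> p :> nat /\ k <> p.+1 :> nat /\ t k = k :> nat).
    rewrite /t -!val_eqE /= qp; case: eqP => [|?]; first by left.
    by case: eqP => ?; right; [left|right].
  have ft k : f (t k) = f k.
    rewrite /t; case: (eqVneq k p) => [->//|_].
    by case: (eqVneq k q) => [->|_].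
  have {}AB : [\/ i = p :> nat /\ (p.+1 < j)%N, i = p.+1 :> nat /\ (p.+1 < j)%N,
      j = p :> nat /\ (i < p)%N | j = p.+1 :> nat /\ (i < p)%N].
    move: AB; rewrite /A /B /= -!val_eqE /= qp.
    case: (eqVneq (i : nat) p) => [ip|ip]; case: (eqVneq (i : nat) p.+1) => [iq|iq];
    case: (eqVneq (j : nat) p) => [jp|jp]; case: (eqVneq (j : nat) p.+1) => [jq|jq] //= _;
    first [by constructor 1; lia | by constructor 2; lia | by constructor 3; lia
          | by constructor 4; lia | by exfalso; lia].
  have tij : (t i < t j)%N by have := tE i; have := tE j; case: AB; lia.
  have tpq : ((t i == p) = (i == q)) * ((t i == q) = (i == p)) *
      (((t j == p) = (j == q)) * ((t j == q) = (j == p))).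
    by rewrite -!val_eqE /= qp; have := tE i; have := tE j; case: AB => -[? ?] ? ?; do ?split; apply/idP/idP; lia.
  have xAB : A (i, j) (+) B (i, j).
    by rewrite /A /B /= -!val_eqE /= qp; case: AB => -[? ?]; apply/addbP; apply/idP/idP; lia.
  split.
  + by rewrite /C /= tij /A /B /s /= !tpq addbC.
  + by rewrite /A /s /= !tpq; move: xAB; rewrite /A /B /= => /addbP ->.
  rewrite /F /= tij ij.
  have -> : ce_args f (t i) (t j) = ce_args f i j.
    apply/ffunP=> k; rewrite !ffunE; case: unlift => [k'|]; last by rewrite !ft.
    rewrite -[RHS]ft; congr (f _); apply: val_inj => /=.
    have := tE (ce_rest i j k'); rewrite /ce_rest !inordK.
    - by have := tE i; have := tE j; rewrite /bump; case: AB; lia.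
    - exact: bump2_lt.
    - exact: bump2_lt.
  rewrite -scaleNr; congr (_ *: _).
  have [-> | ->] : (t i + t j + 1 = (i + j + 1).+1)%N \/ (i + j + 1 = (t i + t j + 1).+1)%N.
    by have := tE i; have := tE j; case: AB; lia.
  + by rewrite exprS mulN1r.
  + by rewrite exprS mulN1r opprK.
Qed.

Definition ce_diff n : ext L n -> ext L n.-1 := ext_lift (@ce_form n).

HB.instance Definition _ n := GRing.isLinear.Build K (ext L n) (ext L n.-1) *:%R
  (@ce_diff n)
  (ext_lift_linear (@ce_form_multilinear n) (@ce_form_alternating n)).

Lemma ce_diff_wedge n (f : {ffun 'I_n -> L}) : ce_diff (wedge f) = ce_form f.
Proof.
exact: (ext_lift_wedge (@ce_form_multilinear n) (@ce_form_alternating n)).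
Qed.

Section WeightedHomology.
Variable grade : nat -> L -> Prop.

(* The weight w part is spanned by the wedges of homogeneous elements whose
   weights add up to w. *)
Definition ext_wt_gen n w (z : ext L n) : Prop :=
  exists (f : {ffun 'I_n -> L}) (k : 'I_n -> nat),
    [/\ forall i, grade (k i) (f i), (\sum_(i < n) k i)%N = w & z = wedge f].

Definition ext_wt n w : pred (ext L n) := span (@ext_wt_gen n w).
HB.instance Definition _ n w := GRing.SubmodClosed.copy (@ext_wt n w)
  (span (@ext_wt_gen n w)).

(* ce_cycle, ce_boundary and homology_wt are the cycles, boundaries and homology
   of the weight w subcomplex. *)
Definition ce_cycle n w : pred (ext L n) :=
  [pred z | (z \in @ext_wt n w) && (ce_diff z == 0)].

Lemma ce_cycle_submod_closed n w : submod_closed (@ce_cycle n w).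
Proof.
split=> [|a u v /andP[uw /eqP du] /andP[vw /eqP dv]]; apply/andP.
  by rewrite rpred0 linear0.
by rewrite rpredD ?rpredZ //= linearP /= du dv scaler0 addr0.
Qed.

HB.instance Definition _ n w := GRing.isSubmodClosed.Build K (ext L n)
  (@ce_cycle n w) (@ce_cycle_submod_closed n w).

Record cycles n w := Cycle { cycle_val :> ext L n; _ : cycle_val \in @ce_cycle n w }.
HB.instance Definition _ n w := [isSub for @cycle_val n w].
HB.instance Definition _ n w := [Choice of cycles n w by <:].
HB.instance Definition _ n w := [SubChoice_isSubLmodule of cycles n w by <:].

Definition ce_boundary n w : pred (cycles n w) :=
  [pred z : cycles n w | `[< exists2 y : ext L n.+1,
     y \in @ext_wt n.+1 w & ce_diff y = cycle_val z >]].

Lemma ce_boundary_submod_closed n w : submod_closed (@ce_boundary n w).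
Proof.
split=> [|a u v].
  by apply/asboolP; exists 0; rewrite ?rpred0 ?linear0.
move=> /asboolP[x xw dx] /asboolP[y yw dy]; apply/asboolP.
by exists (a *: x + y); rewrite ?rpredD ?rpredZ // linearP /= dx dy.
Qed.

HB.instance Definition _ n w := GRing.isSubmodClosed.Build K (cycles n w)
  (@ce_boundary n w) (@ce_boundary_submod_closed n w).

Definition homology_wt n w : Type :=
  quot_mod (GRing.SubmodClosed.clone K (cycles n w) (@ce_boundary n w) _).
HB.instance Definition _ n w := GRing.Lmodule.on (homology_wt n w).

Lemma homology_wt_eq0 n w : (forall h : homology_wt n w, h = 0) <->
  (forall z : ext L n, z \in @ext_wt n w -> ce_diff z = 0 ->
     exists2 y : ext L n.+1, y \in @ext_wt n.+1 w & ce_diff y = z).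
Proof.
split=> [H0 z zw dz|H h].
  have zP : z \in @ce_cycle n w by apply/andP; rewrite zw dz.
  apply/asboolP; rewrite -[asbool _]/(Cycle zP \in @ce_boundary n w).
  by rewrite -quot_pi_eq0; apply/eqP/H0.
rewrite -(quot_pi_repr h); apply/eqP; rewrite quot_pi_eq0.
case: repr => z zP; apply/asboolP => /=.
by case/andP: (zP) => zw /eqP; apply: H.
Qed.

End WeightedHomology.

End ChevalleyEilenberg.


(* The symplectic form of H = Q^(2g) in the basis a_1, .., a_g, b_1, .., b_g. *)
Definition sympl_mx g : 'M[rat]_(g + g) := block_mx 0 1%:M (- 1%:M) 0.

Definition sympl g (x y : 'rV[rat]_(g + g)) : rat :=
  (x *m sympl_mx g *m y^T) 0 0.

(* The symmetric algebra of H is the polynomial ring in a_1, .., a_g,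
   b_1, .., b_g, and S^d H is its part of degree d. *)
Definition linform g (x : 'rV[rat]_(g + g)) : {mpoly rat[g + g]} :=
  \sum_k x 0 k *: 'X_k.

Section Poisson.
Variable g : nat.
Implicit Types p q r : {mpoly rat[g + g]}.

Definition poisson p q : {mpoly rat[g + g]} :=
  \sum_k \sum_l sympl_mx g k l *: (p^`M(k) * q^`M(l)).

Lemma sympl_mx_anti k l : sympl_mx g k l = - sympl_mx g l k.
Proof.
suff : (sympl_mx g)^T = - sympl_mx g.
  by move=> /matrixP/(_ k l); rewrite !mxE => ->; rewrite opprK.
rewrite /sympl_mx tr_block_mx opp_block_mx !trmx0 !oppr0 linearN /= trmx1.
by rewrite opprK.
Qed.

Lemma poisson_linearl q : linear (poisson^~ q).
Proof.
move=> a p r; rewrite /poisson scaler_sumr -big_split; apply: eq_bigr => k _ /=.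
rewrite scaler_sumr -big_split; apply: eq_bigr => l _ /=.
by rewrite linearP /= mulrDl -scalerAl scalerDr !scalerA mulrC.
Qed.

Lemma poisson_anti p q : poisson p q = - poisson q p.
Proof.
rewrite /poisson exchange_big /= -sumrN; apply: eq_bigr => k _.
rewrite -sumrN; apply: eq_bigr => l _.
by rewrite sympl_mx_anti scaleNr mulrC.
Qed.

Lemma poisson_linearr p : linear (poisson p).
Proof.
move=> a q r; rewrite !(poisson_anti p) poisson_linearl.
by rewrite opprD scalerN.
Qed.

Lemma poissonxx p : poisson p p = 0.
Proof.
have /eqP := poisson_anti p p; rewrite -addr_eq0 -mulr2n -scaler_nat scaler_eq0.
by rewrite Num.Theory.pnatr_eq0 => /eqP.
Qed.

Lemma poisson_jacobi p q r :
  poisson p (poisson q r) + poisson q (poisson r p) + poisson r (poisson p q) = 0.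
Proof.
pose I := ('I_(g + g) * 'I_(g + g))%type.
pose m (a : I) := sympl_mx g a.1 a.2.
have PE x y : poisson x y = \sum_(a : I) m a *: (x^`M(a.1) * y^`M(a.2)).
  by rewrite /poisson pair_big.
pose T (x y z : {mpoly rat[g + g]}) := \sum_(a : I) \sum_(b : I)
  (m a * m b) *: (x^`M(a.1) * (y^`M(b.1) * z^`M(b.2)^`M(a.2))).
have TC x y z : T x y z = T y x z.
  rewrite /T exchange_big /=; apply: eq_bigr => a _; apply: eq_bigr => b _.
  by rewrite [m b * _]mulrC mulrCA [z^`M(_)^`M(_)]mderiv_comm.
have E x y z : poisson x (poisson y z) = T x y z - T x z y.
  rewrite PE /T -sumrB; apply: eq_bigr => a _.
  pose sw (b : I) : I := (b.2, b.1).
  have swK : involutive sw by case.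
  have msw b : m (sw b) = - m b by rewrite /m /= sympl_mx_anti.
  rewrite [X in _ - X](reindex_inj (inv_inj swK)) /= -sumrB PE.
  rewrite raddf_sum /= mulr_sumr scaler_sumr; apply: eq_bigr => b _.
  rewrite msw mulrN scaleNr opprK -scalerDr -mulrDr.
  rewrite mderivZ mderivM -scalerAr scalerA; congr (_ *: (_ * _)).
  by rewrite addrC [z^`M(_) * _]mulrC.
rewrite !E (TC q p) (TC r p) (TC r q).
by rewrite [X in X + _]addrC !subrKA subrr.
Qed.

Lemma poisson_linform_prod k l (x : 'I_k -> 'rV_(g + g)) (y : 'I_l -> 'rV_(g + g)) :
  poisson (\prod_i linform (x i)) (\prod_j linform (y j)) =
  \sum_i \sum_j sympl (x i) (y j) *:
    ((\prod_(i' | i' != i) linform (x i')) * \prod_(j' | j' != j) linform (y j')).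
Proof.
have dlin (u : 'rV_(g + g)) s : (linform u)^`M(s) = (u 0 s)%:MP.
  rewrite /linform raddf_sum (bigD1 s) //= big1 ?addr0 => [|t ts].
    by rewrite mderivZ mderivX mnm1E eqxx scale1r (_ : (U_(s) - U_(s))%MM = 0%MM)
      ?mpolyX0 ?alg_mpolyC //; apply/mnmP=> t; rewrite mnmBE subnn mnm0E.
  by rewrite mderivZ mderivX mnm1E (negPf ts) scale0r scaler0.
have dprod n (F : 'I_n -> {mpoly rat[g + g]}) s :
    (\prod_i F i)^`M(s) = \sum_i (F i)^`M(s) * \prod_(j | j != i) F j.
  have := index_enum_uniq 'I_n.
  elim: (index_enum _) => [|i0 r IH]; first by rewrite !big_nil mderivC.
  case/andP=> /= i0r /IH {}IH; rewrite !big_cons eqxx /= mderivM IH.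
  congr (_ * _ + _).
    rewrite [RHS]big_seq_cond [LHS]big_seq_cond; apply: eq_bigl => j.
    by rewrite andbT; case: (boolP (j \in r)) => //= jr; apply/esym; apply: contraNneq i0r => <-.
  rewrite mulr_sumr big_seq [RHS]big_seq; apply: eq_bigr => i ir.
  rewrite big_cons ifT; first by rewrite mulrCA.
  by apply: contraNneq i0r => ->.
transitivity (\sum_s \sum_t \sum_i \sum_j (x i 0 s * sympl_mx g s t * y j 0 t) *:
    ((\prod_(i' | i' != i) linform (x i')) * \prod_(j' | j' != j) linform (y j'))).
  apply: eq_bigr => s _; apply: eq_bigr => t _.
  rewrite !dprod mulr_suml scaler_sumr; apply: eq_bigr => i _.
  rewrite mulr_sumr scaler_sumr; apply: eq_bigr => j _.
  rewrite !dlin !mul_mpolyC -scalerAl -scalerAr !scalerA; congr (_ *: _).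
  by rewrite [sympl_mx _ _ _ * _]mulrC.
under eq_bigr => s _ do rewrite exchange_big /=.
rewrite exchange_big /=; apply: eq_bigr => i _.
under eq_bigr => s _ do rewrite exchange_big /=.
rewrite exchange_big /=; apply: eq_bigr => j _.
rewrite /sympl mxE scaler_suml exchange_big /=; apply: eq_bigr => t _.
rewrite !mxE mulr_suml scaler_suml; apply: eq_bigr => s _.
by [].
Qed.

End Poisson.

Section Cplus.
Variable g : nat.

(* The direct sum of the S^(w+2) H for w >= 1: the polynomials all of whose
   monomials have degree at least 3. *)
Definition cplus_pred : pred {mpoly rat[g + g]} :=
  [pred p | all (fun m => (3 <= mdeg m)%N) (msupp p)].

Let deg_ge d : pred {mpoly rat[g + g]} :=
  [pred p | all (fun m => (d <= mdeg m)%N) (msupp p)].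

Let deg_geP d p :
  reflect (forall m, (mdeg m < d)%N -> p@_m = 0) (p \in deg_ge d).
Proof.
apply: (iffP allP) => H m.
  by move=> md; apply/eqP; rewrite mcoeff_eq0; apply/negP => /H; rewrite leqNgt md.
by rewrite mcoeff_msupp leqNgt => ?; apply/negP => /H /eqP; apply/negP.
Qed.

Lemma cplus_submod_closed : submod_closed cplus_pred.
Proof.
split=> [|a p q]; rewrite -!/(deg_ge 3); first by rewrite inE msupp0.
move=> /deg_geP Hp /deg_geP Hq; apply/deg_geP => m md.
by rewrite mcoeffD mcoeffZ Hp // Hq // mulr0 addr0.
Qed.

HB.instance Definition _ := GRing.isSubmodClosed.Build rat {mpoly rat[g + g]}
  cplus_pred cplus_submod_closed.

Record cplus := Cplus { cplus_val :> {mpoly rat[g + g]}; _ : cplus_val \in cplus_pred }.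
HB.instance Definition _ := [isSub for cplus_val].
HB.instance Definition _ := [Choice of cplus by <:].
HB.instance Definition _ := [SubChoice_isSubLmodule of cplus by <:].

Lemma poisson_cplus (p q : cplus) : poisson p q \in cplus_pred.
Proof.
have dM k (f : cplus) : (f : {mpoly rat[g + g]})^`M(k) \in deg_ge 2.
  case: f => f /= Hf; apply/deg_geP => m md; rewrite mcoeff_mderiv.
  by move/(deg_geP 3): Hf => ->; rewrite ?mul0rn // mdegD mdeg1 addn1.
apply: rpred_sum => k _; apply: rpred_sum => l _; apply: rpredZ.
have /allP Hp := dM k p; have /allP Hq := dM l q.
apply/allP => m /msuppM_le /allpairsP[[u v] /= [/Hp Hu /Hq Hv ->]].
by rewrite mdegD; lia.
Qed.

Definition cplus_lie (p q : cplus) : cplus := Cplus (poisson_cplus p q).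

Fact cplus_lie_linearl q : linear (cplus_lie^~ q).
Proof. by move=> a p r; apply: val_inj; rewrite /= poisson_linearl. Qed.

Fact cplus_lie_linearr p : linear (cplus_lie p).
Proof. by move=> a q r; apply: val_inj; rewrite /= poisson_linearr. Qed.

Fact cplus_liexx p : cplus_lie p p = 0.
Proof. by apply: val_inj; rewrite /= poissonxx. Qed.

Fact cplus_lie_jacobi p q r :
  cplus_lie p (cplus_lie q r) + cplus_lie q (cplus_lie r p)
    + cplus_lie r (cplus_lie p q) = 0.
Proof. by apply: val_inj; rewrite /= poisson_jacobi. Qed.

HB.instance Definition _ := Lmodule_isLie.Build rat cplus
  cplus_lie_linearl cplus_lie_linearr cplus_liexx cplus_lie_jacobi.

(* Elements of weight w; only 0 has weight 0 in cplus. *)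
Definition cplus_grade (w : nat) (p : cplus) : Prop := cplus_val p \is w.+2.-homog.

End Cplus.

Definition cplus_homology g n w : Type := @homology_wt rat (cplus g) (@cplus_grade g) n w.
HB.instance Definition _ g n w := GRing.Lmodule.on (cplus_homology g n w).

(* Main.v *)
Require Import Defs.
From HB Require Import structures.
From mathcomp Require Import all_boot all_order all_algebra.
From mathcomp Require Import zify ring.
From mathcomp Require Import boolp.
From mathcomp.multinomials Require Import freeg mpoly.

Set Implicit Arguments.
Unset Strict Implicit.
Unset Printing Implicit Defensive.

Import GRing.Theory Num.Theory.
Local Open Scope ring_scope.

(** Write A for the weight w part of the second exterior power modulo the
boundaries of the third one, and B(P, Q) in A for the class of P /\ Q, where P
and Q are homogeneous of degrees at least 3 adding up to w + 4.  The form B is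
alternating, and killing the boundaries is precisely the identity
B(P, [Q, R]) = B([P, Q], R) + B(Q, [P, R]).  The second homology vanishes in
weight w as soon as B(P, Q) = chi([P, Q]) for some linear map chi, and that is
what is proved for every such form B ([cocycle_coboundary]).

Polynomials are spanned by powers of linear forms, and a linear form is a vector
of H, so everything is phrased with vectors and orthogonality for mu.  The basic
device is a hyperbolic pair, that is, vectors p, s with mu(p, s) = 1, orthogonal
to given vectors ([hyperbolic_pair]; up to four vectors occur, whence g >= 4):
if P and Q commute with each other and with p and s, then [P p, Q s] = P Q.
Hence any polynomial in the given vectors is a bracket in many ways, and
expanding B on such brackets gives relations.

First relation: for a fixed vector z, the expression B(z^2 p, z^w q) vanishes
when p, q are orthogonal vectors of the orthogonal complement of z, hence it
equals mu(p, q) X(z) for one X(z) in A ([cocycle_center]).  A trace of B over a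
basis of H, in the manner of a Casimir element, is an explicit linear map chi
with chi(z^(w+2)) = X(z) for all z.  Replacing B by B - chi([.,.]) one may assume
that X = 0; it remains to see that then B = 0 ([normal_cocycle_eq0]).

When X = 0, polarising at u + t v with u, v orthogonal gives a vanishing sum of
terms B(p M, s N) with M N = u^e v^q fixed.  The exchange relation
([cocycle_exchange]), which uses a second hyperbolic pair, shows that all terms
are the same up to positive coefficients, so each is zero
([normal_isotropic]).  It follows that B(x^3, v^q y^r) = 0 whenever v is
orthogonal to x and y and q >= 2 ([normal_cube_perp]).  Such elements
already span everything when w >= 4: for mu(x, y) = 1 and a hyperbolic pair p, s
orthogonal to x and y, the vectors t x + p and y - t s are orthogonal for all t,
and interpolation at q = 2, 3, 4, 5 isolates B(x^3, y^(w+1))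
([normal_cube_power]).  Finally cubics generate the Lie algebra. *)

(** * Functions of a rational parameter with values in a vector space *)

Section VectorPolynomials.
Variable A : lmodType rat.

(** Induction on the number of coefficients: the combination
f(2 t) - 2 ^ n f(t) has no term of degree n.  This is the tool that turns
identities valid for all vectors u + t v into polarised ones. *)
Lemma poly_fun_eq0 n (c : nat -> A) :
  (forall t : rat, \sum_(i < n) t ^+ i *: c i = 0) ->
  forall i, (i < n)%N -> c i = 0.
Proof.
elim: n c => [//|n IHn] c c0.
have small i : (i < n)%N -> c i = 0.
  move=> ltin; have: (2 ^+ i - 2 ^+ n : rat) *: c i = 0.
    apply: (IHn (fun i => (2 ^+ i - 2 ^+ n) *: c i)) => // t.
    have := c0 (2 * t); have := congr1 ( *:%R (2 ^+ n : rat)) (c0 t).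
    rewrite scaler0 !big_ord_recr /= => /eqP; rewrite scalerDr addr_eq0 => /eqP e1.
    move/eqP; rewrite addr_eq0 => /eqP e2.
    under eq_bigr => j _ do rewrite scalerA mulrBr scalerBl.
    rewrite sumrB.
    have -> : \sum_(j < n) (t ^+ j * 2 ^+ j) *: c j =
              \sum_(j < n) (2 * t) ^+ j *: c j.
      by apply: eq_bigr => j _; rewrite exprMn mulrC.
    have -> : \sum_(j < n) (t ^+ j * 2 ^+ n) *: c j =
              2 ^+ n *: \sum_(j < n) t ^+ j *: c j.
      by rewrite scaler_sumr; apply: eq_bigr => j _; rewrite scalerA mulrC.
    by rewrite e1 e2 exprMn scalerA subrr.
  move/eqP; rewrite scaler_eq0 subr_eq0 => /orP[|/eqP//].
  by rewrite (inj_eq (ieexprIn _ _)) // ltn_eqF.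
move=> i; rewrite ltnS leq_eqVlt => /orP[/eqP ->|]; last exact: small.
have := c0 1; rewrite big_ord_recr /= expr1n scale1r big1 ?add0r // => j _.
by rewrite small ?scaler0.
Qed.

Lemma poly_fun2_eq0 m n (c : nat -> nat -> A) :
  (forall t : rat, \sum_(i < m) \sum_(j < n) t ^+ (i + j) *: c i j = 0) ->
  forall k, \sum_(i < m) \sum_(j < n | (i + j == k)%N) c i j = 0.
Proof.
move=> c0 k; pose N := (k + m + n).+1.
pose d k := \sum_(i < m) \sum_(j < n | (i + j == k)%N) c i j.
apply: (@poly_fun_eq0 N d) => [t|]; last by rewrite /N; lia.
rewrite -[RHS](c0 t) /d.
under eq_bigr => l _.
  rewrite scaler_sumr; under eq_bigr => i _ do
    rewrite big_mkcond scaler_sumr.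
  over.
rewrite exchange_big; apply: eq_bigr => i _ /=.
rewrite exchange_big; apply: eq_bigr => j _ /=.
have lt : (i + j < N)%N by rewrite /N; have := ltn_ord i; have := ltn_ord j; lia.
rewrite (bigD1 (Ordinal lt)) //= eqxx big1 ?addr0 // => l.
rewrite -val_eqE /= eq_sym => /negPf ->; exact: scaler0.
Qed.

End VectorPolynomials.

(** * The symplectic form and hyperbolic pairs *)

Section SymplecticForm.
Variable g : nat.
Implicit Types (x y z : 'rV[rat]_(g + g)).
Local Notation J := (sympl_mx g).

Fact sympl_linear_l y : linear (fun x => sympl x y : rat^o).
Proof. by move=> a x z; rewrite /sympl !mulmxDl -!scalemxAl !mxE. Qed.

Fact sympl_linear_r x : linear (fun y => sympl x y : rat^o).
Proof. by move=> a y z; rewrite /sympl linearP /= mulmxDr -!scalemxAr !mxE. Qed.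

Lemma symplDl x y z : sympl (x + y) z = sympl x z + sympl y z.
Proof. by have := sympl_linear_l z 1 x y; rewrite !scale1r. Qed.

Lemma symplDr x y z : sympl x (y + z) = sympl x y + sympl x z.
Proof. by have := sympl_linear_r x 1 y z; rewrite !scale1r. Qed.

Lemma sympl0l x : sympl 0 x = 0. Proof. by rewrite /sympl !mul0mx mxE. Qed.

Lemma sympl0r x : sympl x 0 = 0. Proof. by rewrite /sympl trmx0 mulmx0 mxE. Qed.

Lemma symplZl a x y : sympl (a *: x) y = a * sympl x y.
Proof. by have := sympl_linear_l y a x 0; rewrite sympl0l !addr0. Qed.

Lemma symplZr a x y : sympl x (a *: y) = a * sympl x y.
Proof. by have := sympl_linear_r x a y 0; rewrite sympl0r !addr0. Qed.

Lemma tr_sympl_mx : J^T = - J.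
Proof. by apply/matrixP => i j; rewrite mxE [RHS]mxE sympl_mx_anti. Qed.

Lemma sympl_mx_sqr : J *m J = - 1%:M.
Proof.
rewrite /sympl_mx mulmx_block !mul0mx !mulmx0 !addr0 !add0r mulmxN mulNmx mulmx1.
by rewrite -oppr0 -(opp_block_mx 1%:M 0 0 1%:M) -scalar_mx_block.
Qed.

Lemma symplC x y : sympl y x = - sympl x y.
Proof.
have -> : sympl y x = (y *m J *m x^T)^T 0 0 by rewrite mxE.
by rewrite !trmx_mul trmxK tr_sympl_mx mulNmx mulmxN mulmxA mxE.
Qed.

Lemma symplxx x : sympl x x = 0.
Proof.
by have /eqP := symplC x x; rewrite -addr_eq0 -mulr2n mulrn_eq0 => /eqP.
Qed.

Lemma sympl_mx_unit : J \in unitmx.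
Proof.
suff: (- J *m J == 1%:M) by move=> /eqP /mulmx1_unit[].
by rewrite mulNmx sympl_mx_sqr opprK.
Qed.

Lemma sympl_row m n (M : 'M[rat]_(m, g + g)) (N : 'M[rat]_(n, g + g)) i j :
  (M *m J *m N^T) i j = sympl (row i M) (row j N).
Proof.
rewrite /sympl -row_mul mxE [RHS]mxE; apply: eq_bigr => l _.
by rewrite [X in _ = X * _]mxE ![_^T _ _]mxE [X in _ = _ * X]mxE.
Qed.

(** If W, the orthogonal complement of the rows of M, contained no hyperbolic
pair, it would be isotropic, hence of dimension at most g; as dim W = 2 g - rank M,
this forces M to have rank g and W to be Lagrangian, and then the rows
of M, which are orthogonal to W, lie in W and are pairwise orthogonal. *)
Lemma hyperbolic_pair_mx k (M : 'M[rat]_(k, g + g)) :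
  (k < g)%N || (k == g) && (M *m J *m M^T != 0) ->
  exists p s, [/\ p *m J *m M^T = 0, s *m J *m M^T = 0 & sympl p s = 1].
Proof.
move=> kg; pose W := kermx (J *m M^T).
have WM : W *m J *m M^T = 0 by rewrite -mulmxA mulmx_ker.
have full_J : row_full J by rewrite row_full_unit sympl_mx_unit.
have rker m (N : 'M[rat]_(m, g + g)) : \rank (kermx (J *m N^T)) = (g + g - \rank N)%N.
  by rewrite mxrank_ker (eqmxMfull _ full_J) mxrank_tr.
have [W0|] := eqVneq (W *m J *m W^T) 0.
  have WK : (W <= kermx (J *m W^T))%MS by apply/sub_kermxP; rewrite mulmxA.
  have rW : \rank W = (g + g - \rank M)%N by apply: rker.
  have rk := rank_leq_row M; have rM := rank_leq_col M.
  have rWK := rker _ W; have := mxrankS WK; rewrite rWK rW => le.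
  case/orP: kg => [?|/andP[/eqP kg /eqP[]]]; first by exfalso; lia.
  have WW : (kermx (J *m W^T) <= W)%MS.
    by rewrite -(geq_leqif (mxrank_leqif_sup WK)) rWK rW; lia.
  have MK : (M <= kermx (J *m W^T))%MS.
    apply/sub_kermxP; apply: trmx_inj.
    by rewrite trmx_mul (trmx_mul J) trmxK tr_sympl_mx trmx0 mulmxN mulNmx WM oppr0.
  have /submxP[D ->] := submx_trans MK WW.
  by rewrite (trmx_mul D W) mulmxA -!(mulmxA D) W0 mul0mx mulmx0.
move=> /eqP W0.
have [i [j Wij]] : exists i j, sympl (row i W) (row j W) != 0.
  apply: contrapT => no; apply: W0; apply/matrixP => i j; rewrite [RHS]mxE.
  apply: contrapT => /eqP Wij; apply: no; exists i, j.
  by apply: contra_neq Wij => <-; rewrite sympl_row.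
exists (row i W), ((sympl (row i W) (row j W))^-1 *: row j W).
by rewrite -!scalemxAl -!row_mul WM !row0 scaler0 symplZr mulVf.
Qed.

Lemma hyperbolic_pair (l : seq 'rV[rat]_(g + g)) :
  (size l < g)%N || (size l == g) && has (fun x => has (fun y => sympl x y != 0) l) l ->
  exists p s, sympl p s = 1 /\ forall x, x \in l -> sympl x p = 0 /\ sympl x s = 0.
Proof.
move=> sz; pose M : 'M[rat]_(size l, g + g) := \matrix_(i < size l) l`_i.
have MP (i : 'I_(size l)) x : (x *m J *m M^T) 0 i = sympl x l`_i.
  by rewrite sympl_row row_id rowK.
have MMP (i j : 'I_(size l)) : (M *m J *m M^T) i j = sympl l`_i l`_j.
  by rewrite sympl_row !rowK.
have kerP x : x *m J *m M^T = 0 -> forall y, y \in l -> sympl y x = 0.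
  move=> x0 y /(nthP 0)[i il <-]; rewrite symplC -(MP (Ordinal il)) x0.
  by rewrite mxE oppr0.
have [|p [s [p0 s0 ps]]] := @hyperbolic_pair_mx _ M.
  case/orP: sz => [->//|/andP[-> /hasP[x xl /hasP[y yl xy]]]].
  rewrite orbC /=; apply/orP; left; apply: contraNneq xy => M0.
  case/(nthP 0): xl => i il <-; case/(nthP 0): yl => j jl <-.
  by rewrite -(MMP (Ordinal il) (Ordinal jl)) M0 mxE.
by exists p, s; split=> // x xl; split; apply: kerP.
Qed.

End SymplecticForm.

(** * Calculus of the Poisson bracket *)

Section Calculus.
Variable g : nat.
Implicit Types (P Q R : {mpoly rat[g + g]}) (x y z p s : 'rV[rat]_(g + g)).

Lemma linform_linear : linear (@linform g).
Proof.
move=> a x y; rewrite /linform scaler_sumr -big_split; apply: eq_bigr => k _.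
by rewrite !mxE scalerDl scalerA.
Qed.
HB.instance Definition _ := GRing.isLinear.Build rat 'rV[rat]_(g + g)
  {mpoly rat[g + g]} *:%R (@linform g) linform_linear.

Lemma linform_delta k : linform (delta_mx 0 k) = 'X_k :> {mpoly rat[g + g]}.
Proof.
rewrite /linform (bigD1 k) //= big1 => [|l lk]; rewrite mxE !eqxx.
  by rewrite scale1r addr0.
by rewrite (negPf lk) scale0r.
Qed.

Lemma mderiv_linform k x : (linform x)^`M(k) = (x 0 k)%:MP.
Proof.
rewrite /linform raddf_sum (bigD1 k) //= big1 ?addr0 => [|t tk].
  rewrite mderivZ mderivX mnm1E eqxx scale1r (_ : (U_(k) - U_(k))%MM = 0%MM).
    by rewrite mpolyX0 alg_mpolyC.
  by apply/mnmP=> t; rewrite mnmBE subnn mnm0E.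
by rewrite mderivZ mderivX mnm1E (negPf tk) scale0r scaler0.
Qed.

Lemma mderivXn k P n : (P ^+ n.+1)^`M(k) = n.+1%:R *: (P ^+ n * P^`M(k)).
Proof.
elim: n => [|n IHn]; first by rewrite scale1r expr1 expr0 mul1r.
rewrite exprS mderivM {}IHn !scaler_nat exprS -[n.+2]addn1 mulrnDr; ring.
Qed.

Lemma poisson_linform x y : poisson (linform x) (linform y) = (sympl x y)%:MP.
Proof.
have := @poisson_linform_prod g 1 1 (fun=> x) (fun=> y).
rewrite !big_ord1 => ->; rewrite !big1 => [|i|i]; rewrite ?[i]ord1 //.
by rewrite mulr1 alg_mpolyC.
Qed.

Lemma poissonMr P Q R : poisson P (Q * R) = poisson P Q * R + Q * poisson P R.
Proof.
rewrite /poisson mulr_suml mulr_sumr -big_split; apply: eq_bigr => k _ /=.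
rewrite mulr_suml mulr_sumr -big_split; apply: eq_bigr => l _ /=.
by rewrite mderivM -scalerAl -scalerAr -scalerDr; congr (_ *: _); ring.
Qed.

Lemma poissonMl P Q R : poisson (P * Q) R = poisson P R * Q + P * poisson Q R.
Proof.
by rewrite poisson_anti poissonMr !(poisson_anti R) mulNr mulrN opprD !opprK.
Qed.

Lemma poissonXr P Q n :
  poisson P (Q ^+ n.+1) = n.+1%:R *: (Q ^+ n * poisson P Q).
Proof.
elim: n => [|n IHn]; first by rewrite scale1r expr1 expr0 mul1r.
rewrite exprS poissonMr {}IHn !scaler_nat exprS -[n.+2]addn1 mulrnDr; ring.
Qed.

Lemma poissonXl P Q n :
  poisson (Q ^+ n.+1) P = n.+1%:R *: (Q ^+ n * poisson Q P).
Proof. by rewrite poisson_anti poissonXr (poisson_anti P) mulrN scalerN opprK. Qed.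

Lemma poissonDr P Q R : poisson P (Q + R) = poisson P Q + poisson P R.
Proof. by have := poisson_linearr P 1 Q R; rewrite !scale1r. Qed.

Lemma poisson0r P : poisson P 0 = 0.
Proof. by apply: (addrI (poisson P 0)); rewrite -poissonDr !addr0. Qed.

Lemma poissonZr a P Q : poisson P (a *: Q) = a *: poisson P Q.
Proof. by have := poisson_linearr P a Q 0; rewrite addr0 => ->; rewrite poisson0r addr0. Qed.

Definition pcomm P Q := poisson P Q = 0.

Lemma pcomm_eq0 P Q : pcomm P Q -> poisson P Q = 0. Proof. by []. Qed.

Lemma pcommC P Q : pcomm P Q -> pcomm Q P.
Proof. by rewrite /pcomm => PQ; rewrite poisson_anti PQ oppr0. Qed.

Lemma pcommxx P : pcomm P P. Proof. exact: poissonxx. Qed.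

Lemma pcommMr P Q R : pcomm P Q -> pcomm P R -> pcomm P (Q * R).
Proof. by rewrite /pcomm poissonMr => -> ->; rewrite mul0r mulr0 addr0. Qed.

Lemma pcommMl P Q R : pcomm P R -> pcomm Q R -> pcomm (P * Q) R.
Proof. by move=> /pcommC PR /pcommC QR; apply/pcommC/pcommMr. Qed.

Lemma pcommXr P Q n : pcomm P Q -> pcomm P (Q ^+ n).
Proof.
case: n => [|n]; last by rewrite /pcomm poissonXr => ->; rewrite mulr0 scaler0.
move=> _; rewrite expr0; rewrite /pcomm /poisson big1 // => k _; rewrite big1 // => l _.
by rewrite -mpolyC1 mderivC mulr0 scaler0.
Qed.

Lemma pcommXl P Q n : pcomm P Q -> pcomm (P ^+ n) Q.
Proof. by move=> /pcommC PQ; apply/pcommC/pcommXr. Qed.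

Lemma pcomm_linform x y : sympl x y = 0 -> pcomm (linform x) (linform y).
Proof. by rewrite /pcomm poisson_linform => ->; rewrite mpolyC0. Qed.

(** Multiplying by a hyperbolic pair makes products into brackets, up to a
correction by [P, Q]. *)
Lemma poisson_hyperbolic P Q p s :
  sympl p s = 1 -> pcomm P (linform s) -> pcomm (linform p) Q ->
  poisson (P * linform p) (Q * linform s) =
    P * Q + poisson P Q * linform p * linform s.
Proof.
move=> ps Ps pQ; rewrite poissonMl !poissonMr Ps pQ poisson_linform ps mpolyC1; ring.
Qed.

Lemma mderiv_homog d k P : P \is d.+1.-homog -> P^`M(k) \is d.-homog.
Proof.
move=> /dhomogP Pd; apply/dhomogP => m; rewrite mcoeff_msupp mcoeff_mderiv mulrn_eq0 /=.
by rewrite -mcoeff_msupp => /Pd /=; rewrite mdegD mdeg1 addn1 => -[].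
Qed.

Lemma poisson_homog d e P Q : P \is d.-homog -> Q \is e.-homog ->
  (0 < d)%N -> (0 < e)%N -> poisson P Q \is (d + e - 2).-homog.
Proof.
case: d e => [//|d] [//|e] Pd Qe _ _.
rewrite addSn addnS !subSS subn0.
apply: rpred_sum => k _; apply: rpred_sum => l _; apply: rpredZ.
by rewrite dhomogM ?mderiv_homog.
Qed.

Lemma linform_homog x : linform x \is 1.-homog.
Proof. by apply: rpred_sum => k _; apply: rpredZ; rewrite dhomogX /= mdeg1. Qed.

Lemma eq_homog d e P : P \is d.-homog -> d = e -> P \is e.-homog.
Proof. by move=> Pd <-. Qed.

End Calculus.

(** [pcomm] reduces the commutation of products of powers of linear forms to
orthogonality hypotheses in the context. *)
Ltac pcomm :=
  lazymatch goal with
  | |- pcomm (_ * _) _ => apply: pcommMl; pcomm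
  | |- pcomm _ (_ * _) => apply: pcommMr; pcomm
  | |- pcomm (_ ^+ _) _ => apply: pcommXl; pcomm
  | |- pcomm _ (_ ^+ _) => apply: pcommXr; pcomm
  | |- pcomm ?P ?P => apply: pcommxx
  | |- pcomm (linform _) (linform _) =>
      first [ by apply: pcomm_linform | by apply/pcommC/pcomm_linform ]
  | |- pcomm _ _ => first [ assumption | by apply: pcommC ]
  end.

(** [homog_deg] computes the degree of a product of powers of linear forms;
[homogeneous] also compares it with the expected one. *)
Ltac homog_deg :=
  lazymatch goal with
  | |- is_true (linform _ \is _) => apply: linform_homog
  | |- is_true (_ * _ \is _) => apply: dhomogM; homog_deg
  | |- is_true (_ ^+ _ \is _) => apply: dhomogMn; homog_deg
  | |- _ => eassumption
  end.

Ltac homogeneous := apply: eq_homog; [homog_deg | lia].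

(** * Powers of linear forms span homogeneous polynomials *)

Section Powers.
Variables (g : nat) (A : lmodType rat).

(** One replaces the factors of z ^ n by variables one at a time: the
coefficient of t in (z + t x) ^ (n - k) m is (n - k) z ^ (n - k - 1) x m. *)
Lemma linear_powers_eq0 (phi : {linear {mpoly rat[g + g]} -> A}) n :
  (forall z, phi (linform z ^+ n) = 0) -> forall P, P \is n.-homog -> phi P = 0.
Proof.
move=> phi0.
have mono k m : mdeg m = k -> (k <= n)%N -> forall z, phi (linform z ^+ (n - k) * 'X_[m]) = 0.
  elim: k m => [|k IHk] m.
    by move=> /eqP; rewrite mdeg_eq0 => /eqP -> _ z; rewrite mpolyX0 mulr1 subn0.
  move=> mk kn z; have [i mi] : exists i, (0 < m i)%N.
    apply: contrapT => no; suff: mdeg m = 0%N by rewrite mk.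
    apply/eqP; rewrite mdeg_eq0; apply/eqP/mnmP => i; rewrite mnm0E.
    by apply: contrapT => mi; apply: no; exists i; rewrite lt0n; apply/eqP.
  have mE : m = (m - U_(i) + U_(i))%MM.
    by apply/mnmP => j; rewrite mnmDE mnmBE mnm1E; case: eqP => [<-|]; lia.
  have m'k : mdeg (m - U_(i))%MM = k by move: mk; rewrite {1}mE mdegD mdeg1; lia.
  have nk : (n - k = (n - k.+1).+1)%N by lia.
  pose c j := phi (linform z ^+ (n - k - j) * 'X_i ^+ j * 'X_[m - U_(i)] *+ 'C(n - k, j)).
  suff: c 1%N = 0.
    rewrite /c expr1 bin1 subn1 nk /= -mulrA -mpolyXD addmC -mE raddfMn /= => /eqP.
    by rewrite -scaler_nat scaler_eq0 pnatr_eq0 => /eqP.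
  apply: (@poly_fun_eq0 _ (n - k).+1) => [t|]; last by rewrite nk.
  rewrite -[RHS](IHk _ m'k (ltnW kn) (z + t *: delta_mx 0 i)).
  rewrite linearD linearZ /= linform_delta exprDn mulr_suml raddf_sum.
  apply: eq_bigr => j _; rewrite /c -linearZ; congr (phi _).
  by rewrite exprZn mulrnAl -scalerMnr -!scalerAr -!scalerAl.
move=> P Pn; rewrite (mpolyE P) raddf_sum big_seq big1 // => m mP.
rewrite /= linearZ /=; have := mono n m (dhomog_mf Pn mP) (leqnn n) 0.
by rewrite subnn expr0 mul1r => ->; rewrite scaler0.
Qed.

Lemma linear_fun_powers_eq0 (psi : {mpoly rat[g + g]} -> A) n : linear psi ->
  (forall z, psi (linform z ^+ n) = 0) -> forall P, P \is n.-homog -> psi P = 0.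
Proof.
move=> lin psi0.
pose f : {linear {mpoly rat[g + g]} -> A} :=
  HB.pack psi (GRing.isLinear.Build rat {mpoly rat[g + g]} A *:%R psi lin).
exact: (@linear_powers_eq0 f n psi0).
Qed.

End Powers.

(** * Cocycles of weight w and symplectic orthogonality *)

(** The forms of weight w that vanish on the Chevalley-Eilenberg boundaries of
degree 3.  Total degree w + 6 of the three polynomials means total weight w. *)
Record cocycle g w (A : lmodType rat)
    (B : {mpoly rat[g + g]} -> {mpoly rat[g + g]} -> A) : Prop := Cocycle {
  cocycle_linear : forall Q, linear (B^~ Q);
  cocycle_anti : forall P Q, B Q P = - B P Q;
  cocycle_jacobi : forall i j k P Q R,
    P \is i.-homog -> Q \is j.-homog -> R \is k.-homog ->
    [&& 3 <= i, 3 <= j, 3 <= k & i + j + k == w + 6]%N ->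
    B P (poisson Q R) = B (poisson P Q) R + B Q (poisson P R) }.

Section Cocycle.
Variables (g w : nat) (A : lmodType rat).
Variable B : {mpoly rat[g + g]} -> {mpoly rat[g + g]} -> A.
Hypotheses (g4 : (4 <= g)%N) (w4 : (4 <= w)%N) (BP : cocycle w B).
Implicit Types (P Q R : {mpoly rat[g + g]}) (x y z p s : 'rV[rat]_(g + g)).
Local Notation l := (@linform g).

Lemma cocycleC P Q : B Q P = - B P Q. Proof. exact: (cocycle_anti BP). Qed.

Lemma cocycleDl P Q R : B (P + Q) R = B P R + B Q R.
Proof. by have := cocycle_linear BP R 1 P Q; rewrite !scale1r. Qed.

Lemma cocycle0l Q : B 0 Q = 0.
Proof. by apply: (addrI (B 0 Q)); rewrite -cocycleDl !addr0. Qed.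

Lemma cocycleZl a P Q : B (a *: P) Q = a *: B P Q.
Proof. by have := cocycle_linear BP Q a P 0; rewrite cocycle0l !addr0. Qed.

Lemma cocycleDr P Q R : B R (P + Q) = B R P + B R Q.
Proof. by rewrite !(cocycleC _ R) cocycleDl opprD. Qed.

Lemma cocycle0r P : B P 0 = 0. Proof. by rewrite cocycleC cocycle0l oppr0. Qed.

Lemma cocycleZr a P Q : B P (a *: Q) = a *: B P Q.
Proof. by rewrite !(cocycleC _ P) cocycleZl scalerN. Qed.

Lemma cocycleBr P Q R : B R (P - Q) = B R P - B R Q.
Proof. by rewrite -[- Q]scaleN1r cocycleDr cocycleZr scaleN1r. Qed.

Lemma cocycle_suml I (r : seq I) (C : pred I) F Q :
  B (\sum_(i <- r | C i) F i) Q = \sum_(i <- r | C i) B (F i) Q.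
Proof. by apply: (big_morph (B^~ Q)) => [P R|]; rewrite ?cocycleDl ?cocycle0l. Qed.

Lemma cocycle_sumr I (r : seq I) (C : pred I) F P :
  B P (\sum_(i <- r | C i) F i) = \sum_(i <- r | C i) B P (F i).
Proof. by apply: (big_morph (B P)) => [Q R|]; rewrite ?cocycleDr ?cocycle0r. Qed.

Lemma cocycle_pcomm i j k P Q R :
  P \is i.-homog -> Q \is j.-homog -> R \is k.-homog ->
  [&& 3 <= i, 3 <= j, 3 <= k & i + j + k == w + 6]%N ->
  pcomm P Q -> pcomm P R -> B P (poisson Q R) = 0.
Proof.
move=> Pa Qb Rc abc PQ PR.
by rewrite (cocycle_jacobi BP Pa Qb Rc abc) PQ PR cocycle0l cocycle0r addr0.
Qed.

Lemma perp_pair x y z : exists p s, [/\ sympl p s = 1,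
  sympl x p = 0 /\ sympl x s = 0, sympl y p = 0 /\ sympl y s = 0
  & sympl z p = 0 /\ sympl z s = 0].
Proof.
have [|p [s [ps H]]] := @hyperbolic_pair g [:: x; y; z]; first by rewrite /= g4.
by exists p, s; split=> //; apply: H; rewrite !inE eqxx ?orbT.
Qed.

Lemma bracket_hyperbolic P Q p s : sympl p s = 1 -> pcomm P (l s) ->
  pcomm (l p) Q -> pcomm P Q -> poisson (P * l p) (Q * l s) = P * Q.
Proof. by move=> ps Ps pQ PQ; rewrite poisson_hyperbolic // PQ !mul0r addr0. Qed.

(** The factor of degree at least 4 is a bracket of two polynomials that both
commute with the other factor; both degrees cannot be 3 since w is not 2. *)
Lemma cocycle_perp_powers a b x y : sympl x y = 0 ->
  (3 <= a)%N -> (3 <= b)%N -> (a + b = w + 4)%N -> B (l x ^+ a) (l y ^+ b) = 0.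
Proof.
wlog b4 : a b x y / (4 <= b)%N.
  move=> H xy a3 b3 ab; have [b4|b_lt] := leqP 4 b; first exact: H.
  by rewrite cocycleC H ?oppr0 //; [lia|rewrite symplC xy oppr0|lia].
move=> xy a3 _ ab; have [p [s [ps [xp xs] [yp ys] _]]] := perp_pair x y y.
have -> : l y ^+ b = poisson (l y ^+ 2 * l p) (l y ^+ (b - 2) * l s).
  by rewrite bracket_hyperbolic // -?exprD; [congr (_ ^+ _); lia|pcomm..].
apply: cocycle_pcomm; [homog_deg|homog_deg|homog_deg|lia|pcomm|pcomm].
Qed.

Lemma cocycle_perp_triple z p q : sympl z p = 0 -> sympl z q = 0 -> sympl p q = 0 ->
  B (l z ^+ 2 * l p) (l z ^+ w * l q) = 0.
Proof.
move=> zp zq pq; have [p' [s [ps [zp' zs] [pp' psx] [qp' qs]]]] := perp_pair z p q.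
have -> : l z ^+ w * l q = poisson (l z ^+ 2 * l p') (l z ^+ (w - 2) * l q * l s).
  rewrite bracket_hyperbolic //; [|pcomm..].
  by rewrite mulrA -exprD subnKC //; lia.
apply: cocycle_pcomm; [homog_deg|homog_deg|homog_deg|lia|pcomm|pcomm].
Qed.

(** A bilinear form that vanishes on orthogonal pairs of z^perp is a multiple of
mu there: q mu(p, r) - r mu(p, q) is orthogonal to p, so that
mu(p, r) beta(p, q) = mu(p, q) beta(p, r), and likewise on the left. *)
Lemma form_proportional z (beta : 'rV[rat]_(g + g) -> 'rV[rat]_(g + g) -> A) p0 s0 :
  (forall y, linear (beta^~ y)) -> (forall x, linear (beta x)) ->
  (forall p q, sympl z p = 0 -> sympl z q = 0 -> sympl p q = 0 -> beta p q = 0) ->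
  sympl z p0 = 0 -> sympl z s0 = 0 -> sympl p0 s0 = 1 ->
  forall p q, sympl z p = 0 -> sympl z q = 0 ->
    beta p q = sympl p q *: beta p0 s0.
Proof.
move=> linl linr beta0 zp0 zs0 ps0.
have linBr p a x b y : beta p (a *: x - b *: y) = a *: beta p x - b *: beta p y.
  have r0 : beta p 0 = 0.
    by apply: (addrI (beta p 0)); have := linr p 1 0 0; rewrite !scale1r !addr0.
  by rewrite linr -[- (b *: y)]addr0 -scaleNr linr r0 addr0 scaleNr.
have linBl q a x b y : beta (a *: x - b *: y) q = a *: beta x q - b *: beta y q.
  have l0 : beta 0 q = 0.
    by apply: (addrI (beta 0 q)); have := linl q 1 0 0; rewrite !scale1r !addr0.
  by rewrite linl -[- (b *: y)]addr0 -scaleNr linl l0 addr0 scaleNr.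
have movr p q r : sympl z p = 0 -> sympl z q = 0 -> sympl z r = 0 ->
    sympl p r *: beta p q = sympl p q *: beta p r.
  move=> zp zq zr; apply/eqP; rewrite -subr_eq0 -linBr beta0 //.
    by rewrite -scaleNr symplDr !symplZr zq zr !mulr0 addr0.
  by rewrite -scaleNr symplDr !symplZr; apply/eqP; rewrite mulNr subr_eq0 mulrC.
have movl p q r : sympl z p = 0 -> sympl z q = 0 -> sympl z r = 0 ->
    sympl r q *: beta p q = sympl p q *: beta r q.
  move=> zp zq zr; apply/eqP; rewrite -subr_eq0 -linBl beta0 //.
    by rewrite -scaleNr symplDr !symplZr zp zr !mulr0 addr0.
  by rewrite -scaleNr symplDl !symplZl; apply/eqP; rewrite mulNr subr_eq0 mulrC.
have gen p q : sympl z p = 0 -> sympl z q = 0 -> sympl p s0 != 0 ->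
    beta p q = sympl p q *: beta p0 s0.
  move=> zp zq ps; apply: (scalerI ps); rewrite movr // scalerA mulrC -scalerA.
  by congr (_ *: _); have := movl p s0 p0 zp zs0 zp0; rewrite ps0 scale1r.
move=> p q zp zq; have [ps|] := eqVneq (sympl p s0) 0; last exact: gen.
have := gen (1 *: p0 + p) q; rewrite linl scale1r !symplDr !symplDl zp zp0 ps ps0 !addr0.
move=> /(_ erefl zq (oner_neq0 _)); rewrite scale1r scalerDl gen ?ps0 ?oner_neq0 //.
exact: addrI.
Qed.

(** The configuration of the exchange relation: u, v span an isotropic subspace,
and (p, s), (p', s') are orthogonal hyperbolic pairs in its orthogonal
complement. *)
Record two_planes u v p s p' s' : Prop := TwoPlanes {
  planes_uv : sympl u v = 0;
  planes_ps : sympl p s = 1;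
  planes_ps' : sympl p' s' = 1;
  planes_up : sympl u p = 0; planes_us : sympl u s = 0;
  planes_vp : sympl v p = 0; planes_vs : sympl v s = 0;
  planes_up' : sympl u p' = 0; planes_us' : sympl u s' = 0;
  planes_vp' : sympl v p' = 0; planes_vs' : sympl v s' = 0;
  planes_pp' : sympl p p' = 0; planes_psx : sympl p s' = 0;
  planes_sp' : sympl s p' = 0; planes_ss' : sympl s s' = 0 }.

(** For g = 4 the four vectors u, v, p, s are no longer fewer than g, but they are
not pairwise orthogonal, which is enough for [hyperbolic_pair]. *)
Lemma two_planes_exist u v p s : sympl u v = 0 -> sympl p s = 1 ->
  sympl u p = 0 -> sympl u s = 0 -> sympl v p = 0 -> sympl v s = 0 ->
  exists p' s', two_planes u v p s p' s'.
Proof.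
move=> uv ps up us vp vs.
have [|p' [s' [ps' H]]] := @hyperbolic_pair g [:: u; v; p; s].
  rewrite /=.
  by move: g4; rewrite leq_eqVlt => /orP[->|->] //=; rewrite ps oner_neq0 !orbT.
exists p', s'.
have [up' us'] := H u (mem_head _ _).
have [|vp' vs'] := H v; first by rewrite !inE eqxx orbT.
have [|pp' psx] := H p; first by rewrite !inE eqxx !orbT.
have [|sp' ss'] := H s; first by rewrite !inE eqxx !orbT.
by split.
Qed.

(** With P = u^a v^b, R = u^c v^d and Q = u^e v^f, this is the Jacobi identity for
P s s', R p and Q p': the last two commute, while the brackets with the first
replace s s' by s' and by s. *)
Lemma cocycle_exchange u v p s p' s' a b c d e f : two_planes u v p s p' s' ->
  [&& 1 <= a + b, 2 <= c + d, 2 <= e + f & a + b + c + d + e + f == w + 2]%N ->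
  B (l u ^+ c * l v ^+ d * l p) (l u ^+ (a + e) * l v ^+ (b + f) * l s) =
  B (l u ^+ e * l v ^+ f * l p') (l u ^+ (a + c) * l v ^+ (b + d) * l s').
Proof.
case=> uv ps ps' up us vp vs up' us' vp' vs' pp' psx sp' ss' deg.
pose P := l u ^+ a * l v ^+ b.
pose Q := l u ^+ e * l v ^+ f.
pose R := l u ^+ c * l v ^+ d.
have PQ : l u ^+ (a + e) * l v ^+ (b + f) = P * Q by rewrite /P /Q !exprD; ring.
have PR : l u ^+ (a + c) * l v ^+ (b + d) = P * R by rewrite /P /R !exprD; ring.
have Ps : poisson (P * l s * l s') (R * l p) = - (P * R * l s').
  rewrite [P * _ * _]mulrAC poisson_anti bracket_hyperbolic ?/P ?/R //; [|pcomm..].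
  by congr (- _); ring.
have Ps' : poisson (P * l s * l s') (Q * l p') = - (P * Q * l s).
  rewrite poisson_anti bracket_hyperbolic ?/P ?/Q //; [|pcomm..].
  by congr (- _); ring.
have := @cocycle_jacobi _ _ _ _ BP (a + b + 1 + 1) (c + d + 1) (e + f + 1)
  (P * l s * l s') (R * l p) (Q * l p').
rewrite Ps Ps' [poisson (R * _) _](_ : _ = 0); last first.
  by change (pcomm (R * l p) (Q * l p')); rewrite /R /Q; pcomm.
rewrite PQ PR cocycle0r -[- (P * R * _)]scaleN1r -[- (P * Q * _)]scaleN1r.
rewrite cocycleZl cocycleZr !scaleN1r => H.
have {}H : - B (P * R * l s') (Q * l p') - B (R * l p) (P * Q * l s) = 0.
  by apply: esym; apply: H; rewrite ?/P ?/Q ?/R; [homogeneous|homogeneous|homogeneous|lia].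
by rewrite [RHS]cocycleC; apply/eqP; rewrite eq_sym -subr_eq0 H.
Qed.

End Cocycle.

(** * Vanishing of normalized cocycles *)

Section NormalizedCocycle.
Variables (g w : nat) (A : lmodType rat).
Variable B : {mpoly rat[g + g]} -> {mpoly rat[g + g]} -> A.
Hypotheses (g4 : (4 <= g)%N) (w4 : (4 <= w)%N) (BP : cocycle w B).
Hypothesis B_normal : forall z p s, sympl p s = 1 -> sympl z p = 0 ->
  sympl z s = 0 -> B (linform z ^+ 2 * linform p) (linform z ^+ w * linform s) = 0.
Implicit Types (P Q R : {mpoly rat[g + g]}) (x y z p s : 'rV[rat]_(g + g)).
Local Notation l := (@linform g).

(** The coefficient of t ^ q in B((u + t v)^2 p, (u + t v)^w s) = 0 is a
combination with nonnegative coefficients of the three terms S(i, j) below with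
i + j = 2, and these are all equal by the exchange relation. *)
Lemma normal_isotropic u v p s e q : sympl u v = 0 -> sympl p s = 1 ->
  sympl u p = 0 -> sympl u s = 0 -> sympl v p = 0 -> sympl v s = 0 ->
  (2 <= e)%N -> (2 <= q)%N -> (e + q = w + 2)%N ->
  B (l v ^+ 2 * l p) (l u ^+ e * l v ^+ (q - 2) * l s) = 0.
Proof.
move=> uv ps up us vp vs e2 q2 eq.
have [p' [s' pl]] := two_planes_exist g4 uv ps up us vp vs.
pose S p s i j := B (l u ^+ i * l v ^+ j * l p) (l u ^+ (e - i) * l v ^+ (q - j) * l s).
(* Two quadratic monomials can be exchanged when their product divides u^e v^q. *)
have exch i j i' j' : [&& i + j == 2, i' + j' == 2, i + i' <= e & j + j' <= q]%N ->
    S p s i j = S p' s' i' j'.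
  move=> H; rewrite /S.
  have := @cocycle_exchange _ _ _ _ g4 w4 BP u v p s p' s' (e - i - i') (q - j - j') i j i' j' pl.
  have -> : (e - i - i' + i' = e - i)%N by lia.
  have -> : (q - j - j' + j' = q - j)%N by lia.
  have -> : (e - i - i' + i = e - i')%N by lia.
  have -> : (q - j - j' + j = q - j')%N by lia.
  by apply; lia.
have S11 : S p s 1%N 1%N = S p' s' 1%N 1%N by apply: exch; lia.
have S20 : S p s 2%N 0%N = S p' s' 0%N 2%N by apply: exch; lia.
have S02 : S p s 0%N 2%N = S p' s' 2%N 0%N by apply: exch; lia.
(* As e + q >= 6, one of e, q is at least 3, so u v can be exchanged with one of the squares. *)
have [S1 S2] : S p s 1%N 1%N = S p s 0%N 2%N /\ S p s 2%N 0%N = S p s 0%N 2%N.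
  have [e3|q3] : (3 <= e)%N \/ (3 <= q)%N by lia.
    have a : S p s 2%N 0%N = S p' s' 1%N 1%N by apply: exch; lia.
    have b : S p s 1%N 1%N = S p' s' 2%N 0%N by apply: exch; lia.
    by rewrite a -S11 b S02.
  have a : S p s 0%N 2%N = S p' s' 1%N 1%N by apply: exch; lia.
  have b : S p s 1%N 1%N = S p' s' 0%N 2%N by apply: exch; lia.
  by rewrite S20 -b a S11.
pose c j k := ('C(2, j) * 'C(w, k))%:R *:
  B (l u ^+ (2 - j) * l v ^+ j * l p) (l u ^+ (w - k) * l v ^+ k * l s).
have sum0 : \sum_(j < 3) \sum_(k < w.+1 | (j + k == q)%N) c j k = 0.
  apply: poly_fun2_eq0 => t; rewrite -[RHS](@B_normal (u + t *: v) p s) //; first last.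
  - by rewrite symplDl symplZl us vs mulr0 addr0.
  - by rewrite symplDl symplZl up vp mulr0 addr0.
  rewrite linearD linearZ /= !exprDn !mulr_suml (cocycle_suml BP).
  apply: eq_bigr => j _; rewrite (cocycle_sumr BP); apply: eq_bigr => k _.
  rewrite /c !exprZn -!mulrnAl -!scaler_nat -!scalerAr -!scalerAl.
  rewrite !(cocycleZl BP) !(cocycleZr BP) !scalerA; congr (_ *: _).
  by rewrite natrM exprD; ring.
have cE j : (j <= 2)%N -> \sum_(k < w.+1 | (j + k == q)%N) c j k =
    ('C(2, j) * 'C(w, q - j))%:R *: S p s 0%N 2%N.
  move=> j2; have ltq : (q - j < w.+1)%N by lia.
  rewrite (big_pred1 (Ordinal ltq)) => [|k]; last by rewrite /= -val_eqE /=; lia.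
  rewrite /c /=; congr (_ *: _); have -> : (w - (q - j) = e - (2 - j))%N by lia.
  rewrite -/(S p s (2 - j)%N j); case: j j2 {ltq} => [|[|[|]]] //.
have := sum0; rewrite !big_ord_recr big_ord0 /= add0r !cE // -!scalerDl => /eqP.
rewrite scaler_eq0 -!natrD pnatr_eq0 => /orP[|/eqP <-]; last first.
  by rewrite /S expr0 mul1r subn0.
(* The common value is multiplied by a sum of binomials, one of which is positive. *)
suff: (0 < 'C(w, q - 2))%N by rewrite bin1 binn mul1n; lia.
by rewrite bin_gt0; lia.
Qed.

(** Since v^q y^r = [v^2 p, v^(q-2) y^r s] and v^2 p commutes with x^3, only
B(v^2 p, x^2 y^(r-1) v^(q-2) s) is left, which is a polarised form of
[normal_isotropic] for the vectors y + t x. *)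
Lemma normal_cube_perp x y v q r : sympl v x = 0 -> sympl v y = 0 ->
  (2 <= q)%N -> (q + r = w + 1)%N -> B (l x ^+ 3) (l v ^+ q * l y ^+ r) = 0.
Proof.
move=> vx vy q2 qr; have [p [s [ps [xp xs] [yp ys] [vp vs]]]] := perp_pair g4 x y v.
have -> : l v ^+ q * l y ^+ r =
    poisson (l v ^+ 2 * l p) (l v ^+ (q - 2) * l y ^+ r * l s).
  rewrite bracket_hyperbolic //; [|pcomm..].
  by rewrite mulrA -exprD subnKC.
have := @cocycle_jacobi _ _ _ _ BP 3 3 w (l x ^+ 3) (l v ^+ 2 * l p)
  (l v ^+ (q - 2) * l y ^+ r * l s).
rewrite (@pcomm_eq0 _ (l x ^+ 3) (l v ^+ 2 * l p)); last by pcomm.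
rewrite (cocycle0l BP) add0r => ->; [|homogeneous|homogeneous|homogeneous|lia].
case: r qr => [|r] qr.
  rewrite [poisson _ _](_ : _ = 0) ?(cocycle0r BP) //.
  change (pcomm (l x ^+ 3) (l v ^+ (q - 2) * 1 * l s)); rewrite mulr1; pcomm.
have -> : poisson (l x ^+ 3) (l v ^+ (q - 2) * l y ^+ r.+1 * l s) =
    (3 * r.+1%:R * sympl x y) *: (l x ^+ 2 * l y ^+ r * l v ^+ (q - 2) * l s).
  rewrite !poissonMr (@pcomm_eq0 _ (l x ^+ 3) (l s)); last by pcomm.
  rewrite (@pcomm_eq0 _ (l x ^+ 3) (l v ^+ (q - 2))); last by pcomm.
  rewrite poissonXr poissonXl poisson_linform -!mul_mpolyC !mpolyCM !mpolyC_nat; ring.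
rewrite (cocycleZr BP).
pose c i := 'C(r.+2, i)%:R *: B (l v ^+ 2 * l p)
  (l y ^+ (r.+2 - i) * l x ^+ i * l v ^+ (q - 2) * l s).
suff: c 2%N = 0.
  rewrite /c (_ : r.+2 - 2 = r)%N; last by lia.
  move/eqP; rewrite scaler_eq0 pnatr_eq0 eqn0Ngt bin_gt0 /= => /eqP H.
  by rewrite [l x ^+ 2 * _]mulrC H scaler0.
apply: (@poly_fun_eq0 _ r.+3) => // t.
rewrite -[RHS](@normal_isotropic (y + t *: x) v p s r.+2 q) //; first last.
- by lia.
- by rewrite symplDl symplZl ys xs mulr0 addr0.
- by rewrite symplDl symplZl yp xp mulr0 addr0.
- by rewrite symplC symplDr symplZr vx vy mulr0 addr0 oppr0.
rewrite linearD linearZ /= exprDn !mulr_suml (cocycle_sumr BP).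
apply: eq_bigr => i _; rewrite /c exprZn -!mulrnAl -!scaler_nat -!scalerAr -!scalerAl.
by rewrite !(cocycleZr BP) !scalerA.
Qed.

(** The vectors p + t x and y - t s are orthogonal, and (1 + t^2) y is the sum of
y - t s and of t (s + t y), which is orthogonal to y - t s.  So
B((p + t x)^3, (y - t s)^q y^(w+1-q)) = 0 for 2 <= q <= w + 1.  The coefficient
of t^3 is a cubic polynomial in q whose value at q = 0 is B(x^3, y^(w+1)).
As w >= 4, it has the four zeros 2, 3, 4, 5, hence it is zero. *)
Lemma normal_cube_power x y : sympl x y = 1 -> B (l x ^+ 3) (l y ^+ (w + 1)) = 0.
Proof.
move=> xy; have [p [s [ps [xp xs] [yp ys] _]]] := perp_pair g4 x y y.
have yx : sympl y x = - 1 by rewrite symplC xy.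
have sp : sympl s p = - 1 by rewrite symplC ps.
have sx : sympl s x = 0 by rewrite symplC xs oppr0.
have sy : sympl s y = 0 by rewrite symplC ys oppr0.
have vanish t q : (2 <= q)%N -> (q <= w + 1)%N ->
    B (l (p + t *: x) ^+ 3) (l (y - t *: s) ^+ q * l y ^+ (w + 1 - q)) = 0.
  move=> q2 qw; pose v := y - t *: s; pose y1 := s + t *: y.
  have vx : sympl v (p + t *: x) = 0.
    by rewrite /v -scaleNr symplDl !symplDr !symplZl !symplZr yp yx sp sx; ring.
  have vy : sympl v y1 = 0.
    by rewrite /v -scaleNr symplDl !symplDr !symplZl !symplZr !symplxx ys sy; ring.
  have t0 : (1 + t ^+ 2) ^+ (w + 1 - q) != 0.
    by rewrite expf_neq0 // lt0r_neq0 // ltr_pwDl ?sqr_ge0.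
  apply: (scalerI t0); rewrite scaler0 -(cocycleZr BP) scalerAr -exprZn.
  have -> : (1 + t ^+ 2) *: l y = l v + t *: l y1.
    by rewrite -!linearZ -linearD /=; congr linform; rewrite /v /y1 scalerDr addrA subrK
      scalerA scalerDl scale1r.
  rewrite exprDn mulr_sumr (cocycle_sumr BP) big1 // => k _.
  rewrite exprZn -scaler_nat -!scalerAr !(cocycleZr BP) mulrA -exprD.
  rewrite normal_cube_perp ?scaler0 //; last first.
    by have := ltn_ord k; lia.
  by lia.
pose D i := ('C(3, i)%:R * (-1) ^+ (3 - i)) *:
  B (l p ^+ (3 - i) * l x ^+ i) (l y ^+ (w + 1 - (3 - i)) * l s ^+ (3 - i)).
have D0 q : (2 <= q)%N -> (q <= w + 1)%N -> \sum_(i < 4) 'C(q, 3 - i)%:R *: D i = 0.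
  move=> q2 qw.
  pose c i j := ('C(3, i)%:R * ('C(q, j)%:R * (-1) ^+ j)) *:
    B (l p ^+ (3 - i) * l x ^+ i) (l y ^+ (q - j) * l s ^+ j * l y ^+ (w + 1 - q)).
  have c0 : \sum_(i < 4) \sum_(j < q.+1 | (i + j == 3)%N) c i j = 0.
    apply: poly_fun2_eq0 => t; rewrite -[RHS](vanish t q q2 qw).
    rewrite -scaleNr !linearD !linearZ /= !exprDn !mulr_suml (cocycle_suml BP).
    apply: eq_bigr => i _; rewrite (cocycle_sumr BP); apply: eq_bigr => j _.
    rewrite /c !exprZn -!mulrnAl -!scaler_nat -!scalerAr -!scalerAl.
    rewrite !(cocycleZl BP) !(cocycleZr BP) !scalerA; congr (_ *: _).
    by rewrite [(- t) ^+ _]exprNn exprD; ring.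
  rewrite -[RHS]c0; apply: eq_bigr => i _; have i3 := ltn_ord i.
  have [ltq|geq] := leqP (3 - i) q; last first.
    rewrite bin_small // scale0r big1 // => j; have := ltn_ord j; lia.
  have ltq1 : (3 - i < q.+1)%N by lia.
  rewrite (big_pred1 (Ordinal ltq1)) => [|k]; last by rewrite /= -val_eqE /=; lia.
  rewrite /c /D /= scalerA; congr (_ *: B _ _); first by ring.
  by rewrite mulrAC -exprD; congr (_ ^+ _ * _); lia.
have <- : D 3%N = B (l x ^+ 3) (l y ^+ (w + 1)).
  by rewrite /D subnn subn0 !expr0 mul1r !mulr1 scale1r.
(* Lagrange interpolation at 0 from the nodes 2, 3, 4, 5. *)
have comb : 10 *: (\sum_(i < 4) 'C(2, 3 - i)%:R *: D i) -
    20 *: (\sum_(i < 4) 'C(3, 3 - i)%:R *: D i) +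
    15 *: (\sum_(i < 4) 'C(4, 3 - i)%:R *: D i) -
    4 *: (\sum_(i < 4) 'C(5, 3 - i)%:R *: D i) = D 3%N.
  rewrite !scaler_sumr -sumrB -big_split -sumrB /=.
  rewrite (eq_bigr (fun i : 'I_4 => (i == 3%N :> nat)%:R *: D i)) => [|i _].
    by rewrite !big_ord_recr big_ord0 /= !scale0r !add0r scale1r.
  rewrite !scalerA -scalerBl -scalerDl -scalerBl; congr (_ *: _).
  by case: i => [[|[|[|[|[]]]]]].
by rewrite -comb !D0 ?scaler0 ?subr0 ?addr0 //; lia.
Qed.

(** Up to scaling, two vectors are either orthogonal, where [cocycle_perp_powers]
applies, or a hyperbolic pair, where [normal_cube_power] does. *)
Lemma normal_cube P Q : P \is 3.-homog -> Q \is (w + 1).-homog -> B P Q = 0.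
Proof.
move=> P3 Qw; apply: (@linear_fun_powers_eq0 _ _ (B^~ Q) 3) P3 => [|x].
  exact: cocycle_linear BP Q.
apply: (@linear_fun_powers_eq0 _ _ (B (l x ^+ 3)) (w + 1)) Qw => [a R S|y].
  by rewrite (cocycleDr BP) (cocycleZr BP).
have [xy|xy] := eqVneq (sympl x y) 0.
  by apply: (cocycle_perp_powers g4 w4 BP) => //; lia.
have -> : y = sympl x y *: ((sympl x y)^-1 *: y) by rewrite scalerA mulfV ?scale1r.
rewrite linearZ /= exprZn (cocycleZr BP) normal_cube_power ?scaler0 //.
by rewrite symplZr mulVf.
Qed.

(** Induction on the first degree: x^(i+1) = [x^2 p, x^(i-1) s] is a bracket of a
cubic and of a polynomial of degree i. *)
Theorem normal_cocycle_eq0 i j P Q : P \is i.-homog -> Q \is j.-homog ->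
  (3 <= i)%N -> (3 <= j)%N -> (i + j = w + 4)%N -> B P Q = 0.
Proof.
move=> Pi Qj i3; elim: i i3 j P Q Pi Qj => [//|i IHi] i3 j P Q Pi Qj j3 ij.
move: i3; rewrite leq_eqVlt => /orP[/eqP i3|i3].
  by apply: normal_cube; [rewrite i3|rewrite (_ : w + 1 = j)%N //; lia].
apply: (@linear_fun_powers_eq0 _ _ (B^~ Q) i.+1) Pi => [|x].
  exact: cocycle_linear BP Q.
have [p [s [ps [xp xs] _ _]]] := perp_pair g4 x x x.
have -> : l x ^+ i.+1 = poisson (l x ^+ 2 * l p) (l x ^+ (i - 1) * l s).
  by rewrite bracket_hyperbolic // -?exprD; [congr (_ ^+ _); lia|pcomm..].
have xp3 : l x ^+ 2 * l p \is 3.-homog by homogeneous.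
have xsi : l x ^+ (i - 1) * l s \is i.-homog by homogeneous.
have := cocycle_jacobi BP xp3 xsi Qj; rewrite normal_cube //; last first.
  by apply: eq_homog; [apply: poisson_homog; [exact: xsi|exact: Qj|lia|lia]|lia].
rewrite (IHi _ (3 + j - 2)%N (l x ^+ (i - 1) * l s)) //.
- by rewrite addr0 => <- //; lia.
- by apply: poisson_homog; [exact: xp3|exact: Qj|lia|lia].
- lia.
- lia.
Qed.

End NormalizedCocycle.

(** * The symplectic trace of a bilinear form *)

Section Trace.
Variables (g : nat) (A : lmodType rat).
Implicit Types (x y z t : 'rV[rat]_(g + g)).
Local Notation J := (sympl_mx g).
Local Notation e := (delta_mx 0).

(** The contraction of a bilinear form with the bivector dual to mu. *)
Definition sympl_trace (beta : 'rV[rat]_(g + g) -> 'rV[rat]_(g + g) -> A) : A :=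
  \sum_k \sum_l J k l *: beta (e k) (e l).

Lemma eq_sympl_trace beta gamma : (forall x y, beta x y = gamma x y) ->
  sympl_trace beta = sympl_trace gamma.
Proof. by move=> bg; apply: eq_bigr => k _; apply: eq_bigr => l _; rewrite bg. Qed.

Lemma sympl_traceD beta gamma :
  sympl_trace (fun x y => beta x y + gamma x y) = sympl_trace beta + sympl_trace gamma.
Proof.
rewrite -big_split; apply: eq_bigr => k _; rewrite -big_split; apply: eq_bigr => l _.
exact: scalerDr.
Qed.

Lemma sympl_delta_r x l : sympl x (e l) = (x *m J) 0 l.
Proof. by rewrite /sympl trmx_delta -colE mxE. Qed.

Lemma sympl_delta k l : sympl (e k) (e l) = J k l.
Proof. by rewrite sympl_delta_r -rowE mxE. Qed.

Lemma mul_tr_sympl_mx : J *m J^T = 1%:M.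
Proof. by rewrite tr_sympl_mx mulmxN sympl_mx_sqr opprK. Qed.

Lemma sympl_trace_form (X : A) :
  sympl_trace (fun x y => sympl x y *: X) = (g + g)%:R *: X.
Proof.
rewrite /sympl_trace; under eq_bigr => k _.
  under eq_bigr => l _ do rewrite sympl_delta scalerA.
  rewrite -scaler_suml (_ : \sum_l J k l * J k l = 1); last first.
    have /matrixP/(_ k k) := mul_tr_sympl_mx; rewrite mxE [RHS]mxE eqxx => JJ.
    by rewrite -[RHS]JJ; apply: eq_bigr => l _; rewrite [X in _ = _ * X]mxE.
  rewrite scale1r; over.
by rewrite sumr_const card_ord scaler_nat.
Qed.

Lemma sympl_trace_r z (gamma : 'rV[rat]_(g + g) -> A) : linear gamma ->
  sympl_trace (fun x y => sympl z y *: gamma x) = gamma z.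
Proof.
move=> lin.
pose f : {linear 'rV[rat]_(g + g) -> A} :=
  HB.pack gamma (GRing.isLinear.Build rat 'rV[rat]_(g + g) A *:%R gamma lin).
rewrite -[RHS]/(f z) {2}[z]row_sum_delta linear_sum; apply: eq_bigr => k _.
rewrite linearZ /=.
under eq_bigr => l _ do rewrite scalerA.
rewrite -scaler_suml; congr (_ *: _).
have /matrixP/(_ 0 k) : z *m J *m J^T = z by rewrite -mulmxA mul_tr_sympl_mx mulmx1.
move=> <-; rewrite mxE; apply: eq_bigr => l _.
by rewrite sympl_delta_r [J^T _ _]mxE mulrC.
Qed.

Lemma sympl_trace_l z (gamma : 'rV[rat]_(g + g) -> A) : linear gamma ->
  sympl_trace (fun x y => sympl z x *: gamma y) = - gamma z.
Proof.
move=> lin; rewrite -(sympl_trace_r z lin) -sumrN /sympl_trace exchange_big.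
apply: eq_bigr => k _; rewrite -sumrN; apply: eq_bigr => l _.
by rewrite sympl_mx_anti scaleNr.
Qed.

Lemma sympl_dual z : z != 0 -> exists t, sympl z t = 1.
Proof.
move=> z0; have [l zl] : exists l, sympl z (e l) != 0.
  apply: contrapT => no; move/eqP: z0; apply.
  have zJ : z *m J = 0.
    apply/rowP => l; rewrite [RHS]mxE -sympl_delta_r; apply: contrapT => /eqP zl.
    by apply: no; exists l.
  by rewrite -[z]mulmx1 -mul_tr_sympl_mx mulmxA zJ mul0mx.
by exists ((sympl z (e l))^-1 *: e l); rewrite symplZr mulVf.
Qed.

(** Choose t with mu(z, t) = 1.  In a symplectic basis that contains z and t, the
2 g - 2 vectors orthogonal to z and t contribute (2 g - 2) X and the plane of
z and t contributes (a + b) X.  The proof replaces such a basis by the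
projection x - mu(z, x) t onto the orthogonal complement of z. *)
Lemma sympl_trace_adapted z (beta : 'rV[rat]_(g + g) -> 'rV[rat]_(g + g) -> A) X a b :
  z != 0 -> (forall y, linear (beta^~ y)) -> (forall x, linear (beta x)) ->
  (forall x y, sympl z x = 0 -> sympl z y = 0 -> beta x y = sympl x y *: X) ->
  (forall y, beta z y = (a * sympl z y) *: X) ->
  (forall y, beta y z = (b * sympl y z) *: X) ->
  sympl_trace beta = ((g + g)%:R - 2 + a + b) *: X.
Proof.
move=> z0 linl linr perp bl br; have [t zt] := sympl_dual z0.
have tz : sympl t z = - 1 by rewrite symplC zt.
have proj x : sympl z (x - sympl z x *: t) = 0.
  by rewrite -scaleNr symplDr symplZr zt mulr1 subrr.
pose gamma y := beta t y - sympl t y *: X.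
pose delta x := beta x t - sympl x t *: X - sympl z x *: beta t t.
have decomp x y :
    beta x y = sympl x y *: X + sympl z x *: gamma y + sympl z y *: delta x.
  have lB u v c : beta (u - c *: t) v = beta u v - c *: beta t v.
    by rewrite addrC -scaleNr linl scaleNr addrC.
  have rB u v c : beta u (v - c *: t) = beta u v - c *: beta u t.
    by rewrite addrC -scaleNr linr scaleNr addrC.
  have := perp _ _ (proj x) (proj y); rewrite lB !rB => /eqP.
  rewrite !subr_eq => /eqP ->.
  have -> : sympl (x - sympl z x *: t) (y - sympl z y *: t) =
      sympl x y - sympl z x * sympl t y - sympl z y * sympl x t.
    by rewrite -!scaleNr symplDl !symplDr !symplZl !symplZr symplxx; ring.
  rewrite !scalerBl /gamma /delta !scalerBr !scalerA !addrA.
  by rewrite [RHS](ACl (1*3*5*2*6*4))/= [sympl z y * sympl z x]mulrC.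
have lin_sympl x : linear (fun y => sympl x y *: X).
  by move=> c u v; rewrite symplDr symplZr scalerDl scalerA.
have lin_gamma : linear gamma.
  move=> c u v; rewrite /gamma linr lin_sympl scalerBr opprD.
  by rewrite !addrA; congr (_ - _); rewrite -!addrA; congr (_ + _); rewrite addrC.
have lin_delta : linear delta.
  move=> c u v; rewrite /delta linl symplDl symplZl symplDr symplZr !scalerDl.
  rewrite !scalerBr -!scalerA !opprD !addrA.
  by rewrite [LHS](ACl (1*3*5*2*4*6))/=.
rewrite (eq_sympl_trace decomp) !sympl_traceD sympl_trace_form.
rewrite sympl_trace_l // sympl_trace_r // /gamma /delta bl br symplxx scale0r subr0.
by rewrite zt tz -!scalerBl -!scalerDl; congr (_ *: _); ring.
Qed.

End Trace.

(** * Every cocycle factors through the bracket *)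

Section Coboundary.
Variables (g w : nat) (A : lmodType rat).
Variable B : {mpoly rat[g + g]} -> {mpoly rat[g + g]} -> A.
Hypotheses (g4 : (4 <= g)%N) (w4 : (4 <= w)%N) (BP : cocycle w B).
Implicit Types (P Q R : {mpoly rat[g + g]}) (x y z p s : 'rV[rat]_(g + g)).
Local Notation l := (@linform g).
Local Notation e := (delta_mx 0).

(** Besides the pairs in z^perp, the trace below needs the values of
B(z^2 x, z^w y) when x or y is z itself; they come from the brackets
z^w y = [z^2 p, z^(w-2) y s] - 2 mu(z, y) z^(w-1) p s and
z^(w+1) = [z^2 p, z^(w-1) s]. *)
Lemma cocycle_center z : exists X : A, [/\
  forall p q, sympl z p = 0 -> sympl z q = 0 ->
    B (l z ^+ 2 * l p) (l z ^+ w * l q) = sympl p q *: X,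
  forall y, B (l z ^+ 2 * l z) (l z ^+ w * l y) = (3 * sympl z y) *: X &
  forall y, B (l z ^+ 2 * l y) (l z ^+ w * l z) = (w.+1%:R * sympl y z) *: X].
Proof.
have [p0 [s0 [ps0 [zp0 zs0] _ _]]] := perp_pair g4 z z z.
pose X := B (l z ^+ 2 * l p0) (l z ^+ w * l s0).
have center p q : sympl z p = 0 -> sympl z q = 0 ->
    B (l z ^+ 2 * l p) (l z ^+ w * l q) = sympl p q *: X.
  move=> zp zq.
  pose beta p q := B (l z ^+ 2 * l p) (l z ^+ w * l q).
  apply: (@form_proportional g A z beta p0 s0) => //.
  - by move=> y a u v; rewrite /beta linearP mulrDr -scalerAr (cocycleDl BP) (cocycleZl BP).
  - by move=> x a u v; rewrite /beta linearP mulrDr -scalerAr (cocycleDr BP) (cocycleZr BP).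
  - by move=> u v; apply: cocycle_perp_triple.
have zz := symplxx z.
have zw : l z ^+ w = l z ^+ 2 * l z ^+ (w - 2) by rewrite -exprD subnKC; last lia.
have zw1 : l z ^+ (w - 1) = l z * l z ^+ (w - 2) by rewrite -exprS; congr (_ ^+ _); lia.
exists X; split=> // y; have [p [s [ps [zp zs] [yp ys] _]]] := perp_pair g4 z y y.
  have -> : l z ^+ w * l y = poisson (l z ^+ 2 * l p) (l z ^+ (w - 2) * l y * l s) -
      (2 * sympl z y) *: (l z ^+ (w - 1) * l p * l s).
    rewrite poisson_hyperbolic //; [|pcomm..].
    rewrite poissonMr (@pcomm_eq0 _ (l z ^+ 2) (l z ^+ (w - 2))); last by pcomm.
    rewrite poissonXl poisson_linform mul0r add0r.
    rewrite zw zw1 -!mul_mpolyC !mpolyCM !mpolyC_nat; ring.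
  rewrite (cocycleBr BP) (cocycleZr BP) -exprSr.
  have [p' [s' [ps' [zp' zs'] [pp' psx] [sp' ss']]]] := perp_pair g4 z p s.
  (* The correction term z^(w-1) p s is itself a bracket of elements commuting with z. *)
  rewrite [X in _ - _ *: X](_ : _ = 0) ?scaler0 ?subr0; last first.
    have -> : l z ^+ (w - 1) * l p * l s =
        poisson (l z ^+ 2 * l p') (l z ^+ (w - 3) * l p * l s * l s').
      rewrite bracket_hyperbolic //; [|pcomm..].
      by rewrite !mulrA -exprD; congr (_ ^+ _ * _ * _); lia.
    apply: (cocycle_pcomm BP); [homog_deg|homog_deg|homog_deg|lia|pcomm|pcomm].
  have := @cocycle_jacobi _ _ _ _ BP 3 3 w (l z ^+ 3) (l z ^+ 2 * l p)
    (l z ^+ (w - 2) * l y * l s).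
  rewrite (@pcomm_eq0 _ (l z ^+ 3) (l z ^+ 2 * l p)); last by pcomm.
  rewrite (cocycle0l BP) add0r => ->; [|homogeneous|homogeneous|homogeneous|lia].
  have -> : poisson (l z ^+ 3) (l z ^+ (w - 2) * l y * l s) =
      (3 * sympl z y) *: (l z ^+ w * l s).
    rewrite !poissonMr (@pcomm_eq0 _ (l z ^+ 3) (l s)); last by pcomm.
    rewrite (@pcomm_eq0 _ (l z ^+ 3) (l z ^+ (w - 2))); last by pcomm.
    rewrite poissonXl poisson_linform zw -!mul_mpolyC !mpolyCM !mpolyC_nat; ring.
  by rewrite (cocycleZr BP) center // ps scale1r.
have -> : l z ^+ w * l z = poisson (l z ^+ 2 * l p) (l z ^+ (w - 1) * l s).
  rewrite bracket_hyperbolic //; [|pcomm..].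
  by rewrite -exprSr -exprD; congr (_ ^+ _); lia.
have := @cocycle_jacobi _ _ _ _ BP 3 3 w (l z ^+ 2 * l y) (l z ^+ 2 * l p)
    (l z ^+ (w - 1) * l s).
move=> ->; [|homogeneous|homogeneous|homogeneous|lia].
have -> : poisson (l z ^+ 2 * l y) (l z ^+ 2 * l p) =
    (2 * sympl y z) *: (l z ^+ 3 * l p).
  rewrite poissonMr (@pcomm_eq0 _ (l z ^+ 2 * l y) (l p)); last by pcomm.
  rewrite poissonXr poissonMl (@pcomm_eq0 _ (l z ^+ 2) (l z)); last by pcomm.
  rewrite poisson_linform -!mul_mpolyC !mpolyCM !mpolyC_nat; ring.
have -> : poisson (l z ^+ 2 * l y) (l z ^+ (w - 1) * l s) =
    ((w - 1)%:R * sympl y z) *: (l z ^+ w * l s).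
  rewrite poissonMr (@pcomm_eq0 _ (l z ^+ 2 * l y) (l s)); last by pcomm.
  have -> : (w - 1 = (w - 2).+1)%N by lia.
  rewrite poissonXr poissonMl (@pcomm_eq0 _ (l z ^+ 2) (l z)); last by pcomm.
  rewrite poisson_linform zw -!mul_mpolyC !mpolyCM !mpolyC_nat; ring.
rewrite (cocycleZl BP) (cocycleZr BP) center // ps scale1r.
have [p' [s' pl]] := two_planes_exist g4 zz ps zp zs zp zs.
have := @cocycle_exchange _ _ _ _ g4 w4 BP _ _ _ _ _ _ (w - 3) 0 3 0 2 0 pl.
have -> : (w - 3 + 2 = w - 1)%N by lia.
have -> : (w - 3 + 3 = w)%N by lia.
rewrite !expr0 !mulr1 => ->; last by lia.
case: pl => _ _ ps' _ _ _ _ zp' zs' _ _ _ _ _ _.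
rewrite center // ps' scale1r -scalerDl -mulrDl; congr (_ * _ *: _).
by rewrite -natrD; congr _%:R; lia.
Qed.

(** Up to a factor, the second derivatives of N compute its component N' N'' in
bidegree (2, w); then B(N' x, N'' y) is traced over x and y.  This is the
Sp-invariant way to lift N to a combination of pairs, so that a multiple of it is
the only candidate for chi. *)
Definition polarization (N : {mpoly rat[g + g]}) : A :=
  \sum_a \sum_b sympl_trace (fun x y => B ('X_a * 'X_b * l x) (N^`M(a)^`M(b) * l y)).

Lemma polarization_linear : linear polarization.
Proof.
move=> c M N; rewrite /polarization !scaler_sumr -big_split; apply: eq_bigr => a _ /=.
rewrite scaler_sumr -big_split; apply: eq_bigr => b _ /=.
rewrite /sympl_trace !scaler_sumr -big_split; apply: eq_bigr => k _ /=.
rewrite scaler_sumr -big_split; apply: eq_bigr => m _ /=.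
rewrite !linearP /= mulrDl -scalerAl (cocycleDr BP) (cocycleZr BP) scalerDr !scalerA.
by rewrite mulrC.
Qed.

Lemma polarization_power z : polarization (l z ^+ w.+2) =
  (w.+2 * w.+1)%:R *: sympl_trace (fun x y => B (l z ^+ 2 * l x) (l z ^+ w * l y)).
Proof.
rewrite /polarization /sympl_trace scaler_sumr.
under eq_bigr => a _ do rewrite exchange_big /=.
rewrite exchange_big; apply: eq_bigr => k _ /=; rewrite scaler_sumr.
under eq_bigr => a _ do rewrite exchange_big /=.
rewrite exchange_big; apply: eq_bigr => m _ /=.
rewrite scalerA mulrC -scalerA.
under eq_bigr => a _ do rewrite -scaler_sumr.
rewrite -scaler_sumr; congr (_ *: _).
have -> : l z ^+ 2 * l (e k) = \sum_a \sum_b (z 0 a * z 0 b) *: ('X_a * 'X_b * l (e k)).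
  move: (l (e k)) => L; rewrite expr2 /linform !mulr_suml; apply: eq_bigr => a _.
  rewrite mulr_sumr mulr_suml; apply: eq_bigr => b _.
  by rewrite -scalerAr -!scalerAl scalerA mulrC.
rewrite (cocycle_suml BP) scaler_sumr; apply: eq_bigr => a _.
rewrite (cocycle_suml BP) scaler_sumr; apply: eq_bigr => b _.
rewrite mderivXn mderiv_linform mderivZ [_ * (z 0 a)%:MP]mulrC mderiv_mulC mderivXn mderiv_linform.
rewrite [_ * (z 0 b)%:MP]mulrC !mul_mpolyC !scalerA -!scalerAl.
rewrite (cocycleZr BP) (cocycleZl BP) scalerA; congr (_ *: _).
by rewrite natrM; ring.
Qed.

(** The constant c is the product of the factor (w+2)(w+1) of the double
derivative of z^(w+2) and of the trace 2 g - 2 + 3 + (w + 1) found for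
B(z^2 x, z^w y). *)
Theorem cocycle_coboundary : exists chi : {mpoly rat[g + g]} -> A, linear chi /\
  forall i j P Q, P \is i.-homog -> Q \is j.-homog ->
    (3 <= i)%N -> (3 <= j)%N -> (i + j = w + 4)%N -> B P Q = chi (poisson P Q).
Proof.
pose c : rat := (w.+2 * w.+1)%:R * ((g + g) + w.+2)%:R.
have c0 : c != 0 by rewrite /c -natrM pnatr_eq0; lia.
pose chi N := c^-1 *: polarization N.
have chi_lin : linear chi.
  by move=> a M N; rewrite /chi polarization_linear scalerDr !scalerA mulrC.
have chi0 : chi 0 = 0.
  by apply: (addrI (chi 0)); have := chi_lin 1 0 0; rewrite !scale1r !addr0.
have chiD M N : chi (M + N) = chi M + chi N.
  by have := chi_lin 1 M N; rewrite !scale1r.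
have chiZ a M : chi (a *: M) = a *: chi M.
  by have := chi_lin a M 0; rewrite chi0 !addr0.
exists chi; split=> // i j P Q Pi Qj i3 j3 ij.
pose D P Q := B P Q - chi (poisson P Q).
suff: D P Q = 0 by move/eqP; rewrite subr_eq0 => /eqP.
have DP : cocycle w D.
  split=> [S a M N|M N|a b d M N S Ma Nb Sd abd].
  - rewrite /D (cocycleDl BP) (cocycleZl BP) poisson_linearl chi_lin.
    move: (chi (poisson M S)) (chi (poisson N S)) (B M S) (B N S) => x y u v.
    by rewrite scalerBr opprD [LHS]addrACA.
  - rewrite /D (cocycleC BP M N) (poisson_anti N) -[- poisson M N]scaleN1r chiZ.
    by rewrite scaleN1r opprD.
  - rewrite /D (cocycle_jacobi BP Ma Nb Sd abd) addrACA; congr (_ + _).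
    rewrite -opprD -chiD; congr (- chi _).
    have := poisson_jacobi M N S; rewrite (poisson_anti S M) (poisson_anti S).
    rewrite -[- poisson M S]scaleN1r poissonZr scaleN1r => /eqP.
    by rewrite -addrA -opprD subr_eq0 addrC => /eqP.
apply: (@normal_cocycle_eq0 _ _ _ D g4 w4 DP _ i j) => // z p s ps zp zs.
have [->|z0] := eqVneq z 0.
  rewrite linear0 expr0n /= mul0r /D (cocycle0l BP) poisson_anti poisson0r oppr0.
  by rewrite chi0 subr0.
have [X [center zl zr]] := cocycle_center z.
rewrite /D center // ps scale1r bracket_hyperbolic //; [|pcomm..].
rewrite -exprD /chi polarization_power.
rewrite (@sympl_trace_adapted _ _ z _ X 3 w.+1%:R) //; last 2 first.
- by move=> y a u v; rewrite linearP mulrDr -scalerAr (cocycleDl BP) (cocycleZl BP).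
- by move=> x a u v; rewrite linearP mulrDr -scalerAr (cocycleDr BP) (cocycleZr BP).
rewrite !scalerA -mulrA (_ : (_ * (_ + _)) = c) ?mulVf ?scale1r ?subrr //.
by rewrite /c; congr (_ * _); rewrite -[w.+2]addn2 -[w.+1]addn1 !natrD; ring.
Qed.

End Coboundary.

(** * From cocycles to the homology of the exterior powers *)

Section Assembly.
Variables (g w : nat).
Local Notation L := (cplus g).
Local Notation E n := (ext L n).
Local Notation wt n := (@ext_wt rat L (@cplus_grade g) n w).

Definition boundary : pred (E 2) := [pred z | `[< exists2 y : E 3,
  y \in wt 3 & ce_diff y = z >]].

Lemma boundary_submod_closed : submod_closed boundary.
Proof.
split=> [|a u v]; first by apply/asboolP; exists 0; rewrite ?rpred0 ?linear0.
move=> /asboolP[x xw dx] /asboolP[y yw dy]; apply/asboolP.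
by exists (a *: x + y); rewrite ?rpredD ?rpredZ // linearP /= dx dy.
Qed.

HB.instance Definition _ := GRing.isSubmodClosed.Build rat (E 2) boundary
  boundary_submod_closed.

Definition boundary_mod := GRing.SubmodClosed.clone rat (E 2) boundary _.
Local Notation A := (quot_mod boundary_mod).

(** A linear projection of all polynomials onto the Lie algebra (in the degrees
that occur in weight w), which lets B be defined on all polynomials. *)
Definition truncation (p : {mpoly rat[g + g]}) : {mpoly rat[g + g]} :=
  \sum_(3 <= d < w + 4) pihomog mdeg d p.

Lemma truncation_cplus p : truncation p \in cplus_pred (g := g).
Proof.
rewrite /truncation big_seq; apply: rpred_sum => d; rewrite mem_index_iota => /andP[d3 _].
apply/allP => m /(dhomog_mf (pihomogP _ _ _)) /= ->; exact: d3.
Qed.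

Definition to_cplus p : L := Cplus (truncation_cplus p).

Lemma to_cplus_linear : linear to_cplus.
Proof.
move=> a p q; apply: val_inj => /=; rewrite /truncation scaler_sumr -big_split.
by apply: eq_bigr => d _ /=; rewrite linearP.
Qed.

Lemma truncation_homog d p : p \is d.-homog -> (3 <= d)%N -> (d < w + 4)%N ->
  truncation p = p.
Proof.
move=> pd d3 dw; rewrite /truncation (bigD1_seq d) /= ?mem_index_iota ?d3 ?iota_uniq //.
rewrite pihomog_dE // big1 ?addr0 // => e ed.
by apply: (@pihomog_ne0 _ _ _ d e p) => //; rewrite eq_sym.
Qed.

Lemma to_cplusK d (x : L) : cplus_val x \is d.-homog -> (3 <= d)%N -> (d < w + 4)%N ->
  to_cplus (cplus_val x) = x.
Proof. by move=> xd d3 dw; apply: val_inj; apply: (truncation_homog xd). Qed.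

Definition pair2 (x y : L) : {ffun 'I_2 -> L} := [ffun i => if i == ord0 then x else y].

Lemma ord2E (i : 'I_2) : i = ord0 \/ i = ord_max.
Proof. by case: i => [[|[|//]] lt]; [left|right]; apply: val_inj. Qed.

Lemma pair2_eta (f : {ffun 'I_2 -> L}) : f = pair2 (f ord0) (f ord_max).
Proof. by apply/ffunP => i; rewrite ffunE; case: (ord2E i) => ->. Qed.

Definition wedge2 x y : E 2 := wedge (pair2 x y).

Lemma wedge2_linear_l y : linear (wedge2^~ y).
Proof.
move=> a x x'.
have pairE z : pair2 z y = upd (pair2 0 y) ord0 z.
  by apply/ffunP => i; rewrite !ffunE; case: (ord2E i) => ->.
rewrite /wedge2 (pairE (_ + _)) (pairE x) (pairE x'); exact: wedge_multilinear.
Qed.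

Lemma wedge2_linear_r x : linear (wedge2 x).
Proof.
move=> a y y'.
have pairE z : pair2 x z = upd (pair2 x 0) ord_max z.
  by apply/ffunP => i; rewrite !ffunE; case: (ord2E i) => ->.
rewrite /wedge2 (pairE (_ + _)) (pairE y) (pairE y'); exact: wedge_multilinear.
Qed.

Lemma wedge2xx x : wedge2 x x = 0.
Proof. by apply: (@wedge_alternating _ _ _ _ ord0 ord_max); rewrite // !ffunE. Qed.

Lemma wedge2C x y : wedge2 y x = - wedge2 x y.
Proof.
have Dl u v z : wedge2 (u + v) z = wedge2 u z + wedge2 v z.
  by have := wedge2_linear_l z 1 u v; rewrite !scale1r.
have Dr u v z : wedge2 z (u + v) = wedge2 z u + wedge2 z v.
  by have := wedge2_linear_r z 1 u v; rewrite !scale1r.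
have /eqP := wedge2xx (x + y); rewrite Dl !Dr !wedge2xx add0r addr0 addrC addr_eq0.
by move/eqP.
Qed.

Definition bracket_class (p q : {mpoly rat[g + g]}) : A :=
  quot_pi boundary_mod (wedge2 (to_cplus p) (to_cplus q)).

Lemma ce_diff_wedge3 (f : {ffun 'I_3 -> L}) :
  let f0 := f ord0 in let f1 := f (inord 1) in let f2 := f (inord 2) in
  ce_diff (wedge f) =
    wedge2 (lie f0 f1) f2 - wedge2 (lie f0 f2) f1 + wedge2 (lie f1 f2) f0 :> E 2.
Proof.
move=> f0 f1 f2; rewrite ce_diff_wedge /=.
have i0 : ord0 = inord 0 :> 'I_3 by apply: val_inj; rewrite /= inordK.
have argsE (i j k : nat) : (i < 3)%N -> (j < 3)%N -> bump j (bump i 0) = k -> (k < 3)%N ->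
    ce_args f (inord i) (inord j) = pair2 (lie (f (inord i)) (f (inord j))) (f (inord k)).
  move=> i3 j3 kE k3; apply/ffunP => m; rewrite !ffunE.
  case: (ord2E m) => ->; first by rewrite unlift_none eqxx.
  have -> : ord_max = fintype.lift ord0 (ord0 : 'I_1) by apply: val_inj.
  by rewrite liftK /ce_rest !inordK // -kE.
pose F i j : E 2 := (-1) ^+ (i + j + 1) *: wedge (ce_args f (inord i) (inord j)).
transitivity (\sum_(i < 3) \sum_(j < 3 | (i < j)%N) F i j).
  by apply: eq_bigr => i _; apply: eq_bigr => j _; rewrite /F !inord_val.
have -> : \sum_(i < 3) \sum_(j < 3 | (i < j)%N) F i j = F 0%N 1%N + F 0%N 2%N + F 1%N 2%N.
  under eq_bigr => i _ do rewrite big_mkcond /=.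
  by rewrite !big_ord_recr !big_ord0 /= !add0r !addr0.
rewrite /F (argsE 0 1 2)%N // (argsE 0 2 1)%N // (argsE 1 2 0)%N // -!i0.
have -> : (-1) ^+ (0 + 1 + 1) = 1 :> rat by rewrite -signr_odd.
have -> : (-1) ^+ (0 + 2 + 1) = - 1 :> rat by rewrite -signr_odd.
have -> : (-1) ^+ (1 + 2 + 1) = 1 :> rat by rewrite -signr_odd.
by rewrite !scale1r scaleN1r.
Qed.

Lemma ce_diff_wedge2 (f : {ffun 'I_2 -> L}) :
  ce_diff (wedge f) = wedge [ffun=> lie (f ord0) (f ord_max)] :> E 1.
Proof.
rewrite ce_diff_wedge /=.
have i0 : ord0 = inord 0 :> 'I_2 by apply: val_inj; rewrite /= inordK.
have i1 : ord_max = inord 1 :> 'I_2 by apply: val_inj; rewrite /= inordK.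
pose F i j : E 1 := (-1) ^+ (i + j + 1) *: wedge (ce_args f (inord i) (inord j)).
transitivity (\sum_(i < 2) \sum_(j < 2 | (i < j)%N) F i j).
  by apply: eq_bigr => i _; apply: eq_bigr => j _; rewrite /F !inord_val.
have -> : \sum_(i < 2) \sum_(j < 2 | (i < j)%N) F i j = F 0%N 1%N.
  under eq_bigr => i _ do rewrite big_mkcond /=.
  by rewrite !big_ord_recr !big_ord0 /= !add0r !addr0.
rewrite /F (_ : (-1) ^+ (0 + 1 + 1) = 1) ?scale1r; last by rewrite -signr_odd.
rewrite -i0 -i1; congr wedge.
by apply/ffunP => k; rewrite !ffunE [k]ord1 unlift_none.
Qed.

Definition first_entry (f : {ffun 'I_1 -> L}) : L := f ord0.

Lemma first_entry_multilinear : multilinear first_entry.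
Proof. by move=> f i a x y; rewrite /first_entry !ffunE [i]ord1 eqxx. Qed.

Lemma first_entry_alternating : alternating first_entry.
Proof. by move=> f i j; rewrite [i]ord1 [j]ord1 eqxx. Qed.

(** The Jacobi-type identity is the vanishing of the class of the boundary of
P /\ Q /\ R. *)
Lemma bracket_class_cocycle : cocycle w bracket_class.
Proof.
split=> [Q a P P'|P Q|i j k P Q R Pi Qj Rk /and4P[i3 j3 k3 /eqP ijk]].
- rewrite /bracket_class to_cplus_linear wedge2_linear_l; exact: linearP.
- by rewrite /bracket_class wedge2C linearN.
have lieE d e S T : S \is d.-homog -> T \is e.-homog -> (3 <= d)%N -> (3 <= e)%N ->
    (d + e <= w + 3)%N -> lie (to_cplus S) (to_cplus T) = to_cplus (poisson S T).
  move=> Sd Te d3 e3 de; apply: val_inj => /=.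
  rewrite (truncation_homog Sd) ?(truncation_homog Te) //; try by lia.
  by rewrite (@truncation_homog (d + e - 2)) //; [apply: (poisson_homog Sd Te); lia|lia|lia].
pose f : {ffun 'I_3 -> L} := [ffun m : 'I_3 =>
  to_cplus (nth 0 [:: P; Q; R] m)].
pose deg (m : 'I_3) := (nth 0%N [:: i; j; k] m - 2)%N.
have : quot_pi boundary_mod (ce_diff (wedge f) : E 2) = 0.
  apply/eqP; rewrite quot_pi_eq0; apply/asboolP; exists (wedge f) => //.
  apply: span_gen; exists f, deg; split=> //.
    move=> m; rewrite ffunE /cplus_grade /deg /=.
    case: m => [[|[|[|//]]] lt] /=.
    - by rewrite (truncation_homog Pi) //; [apply: (eq_homog Pi); lia|lia].
    - by rewrite (truncation_homog Qj) //; [apply: (eq_homog Qj); lia|lia].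
    - by rewrite (truncation_homog Rk) //; [apply: (eq_homog Rk); lia|lia].
  rewrite !big_ord_recr big_ord0 /deg /=; lia.
rewrite ce_diff_wedge3 !ffunE !inordK //=.
rewrite (lieE _ _ _ _ Pi Qj i3 j3) ?(lieE _ _ _ _ Pi Rk i3 k3) ?(lieE _ _ _ _ Qj Rk j3 k3);
  try by lia.
rewrite linearD linearB /= -!/(bracket_class _ _) => /eqP.
rewrite addrC addr_eq0 opprB => /eqP H.
have anti X Y : bracket_class Y X = - bracket_class X Y.
  by rewrite /bracket_class wedge2C linearN.
by rewrite (anti (poisson Q R)) H opprB (anti (poisson P R)) addrC.
Qed.

(** On the weight w part, the class of z equals chi applied to the boundary of z:
both are linear and agree on generators. *)
Lemma weight_class_eq0 (g4 : (4 <= g)%N) (w4 : (4 <= w)%N) (z : E 2) :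
  z \in wt 2 -> ce_diff z = 0 -> quot_pi boundary_mod z = 0.
Proof.
have [chi [chi_lin chiP]] := cocycle_coboundary g4 w4 bracket_class_cocycle.
pose low : {linear E 1 -> L} := HB.pack (ext_lift first_entry)
  (GRing.isLinear.Build rat (E 1) L *:%R (ext_lift first_entry)
    (ext_lift_linear first_entry_multilinear first_entry_alternating)).
have chi_val_lin : linear (fun x : L => chi (cplus_val x)).
  by move=> a x y; rewrite -chi_lin.
pose chi_val : {linear L -> A} := HB.pack (fun x : L => chi (cplus_val x))
  (GRing.isLinear.Build rat L A *:%R (fun x : L => chi (cplus_val x)) chi_val_lin).
have dz0 : chi_val (low (ce_diff (0 : E 2))) = 0 by rewrite !linear0.
move=> zw dz; have -> : quot_pi boundary_mod z = chi_val (low (ce_diff z)).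
  have [s [gen ->]] := spanP _ _ zw.
  rewrite !linear_sum; apply: eq_big_seq => t /gen [u [k [grade sum_k uE]]].
  rewrite !linearZ /=; congr (_ *: _); rewrite {}uE.
  (* A quadratic polynomial without terms of degree less than 3 is zero. *)
  have zero i : (k i < 1)%N -> u i = 0.
    rewrite ltnS leqn0 => /eqP ki.
    apply: val_inj => /=; apply/eqP; have := grade i; rewrite /cplus_grade ki.
    case: (u i) => p /= /allP p3 /dhomogP p2; rewrite -msupp_eq0.
    case: (msupp p) p3 p2 => // m ms /(_ m (mem_head _ _)) m3 /(_ m (mem_head _ _)) /= m2.
    by rewrite m2 in m3.
  have wedge0 i : (k i < 1)%N -> wedge u = 0 :> E 2.
    by move=> /zero ui; apply: (multilinear0 (@wedge_multilinear _ _ _) ui).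
  move: sum_k; rewrite !big_ord_recr big_ord0 /= add0n => sum_k.
  have {}sum_k : (k ord0 + k ord_max = w)%N.
    by rewrite -sum_k; congr (k _ + k _)%N; apply: val_inj.
  have [/wedge0->|k0] := ltnP (k ord0) 1; first by rewrite [LHS]linear0 -dz0.
  have [/wedge0->|k1] := ltnP (k ord_max) 1; first by rewrite [LHS]linear0 -dz0.
  rewrite [ce_diff _](@ce_diff_wedge2 u).
  rewrite (ext_lift_wedge first_entry_multilinear first_entry_alternating).
  rewrite /first_entry ffunE -[RHS]/(chi (poisson (u ord0) (u ord_max))).
  have := grade ord0; have := grade ord_max; rewrite /cplus_grade => g1 g0.
  rewrite -(chiP _ _ _ _ g0 g1) //; [|lia].
  rewrite /bracket_class (to_cplusK g0) ?(to_cplusK g1) //; try lia.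
  by rewrite /wedge2 -pair2_eta.
by rewrite dz !linear0.
Qed.

End Assembly.

Theorem theorem1p1 (g w : nat) (hg : (4 <= g)%N) (hw : (4 <= w)%N) :
  forall h : cplus_homology g 2 w, h = 0.
Proof.
apply/homology_wt_eq0 => z zw dz.
have /eqP := weight_class_eq0 hg hw zw dz; rewrite quot_pi_eq0.
by move=> /asboolP.
Qed.
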